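(* Let $\mathcal{G}=(G_\lambda)_{\lambda\in\mathbb{N}}$ be a sequence of graphs with $|V(G_\lambda)|\to\infty$ and $\rho(G_\lambda)\to\infty$ as $\lambda\to\infty$. Define a function $t_{\mathcal{G}}(\lambda)=\rho(G_\lambda)/\ln\rho(G_\lambda)$. If $$\lim_{\lambda\to\infty}\frac{\ln\rho(G_\lambda)}{\ln\ln|V(G_\lambda)|}=\infty,$$ then $t_{\mathcal{G}}(\lambda)$ is a DP-threshold function for $\mathcal{G}$. Furthermore, if $$\lim_{\lambda\to\infty}\frac{\ln\rho(G_\lambda)}{\ln|V(G_\lambda)|}=1,$$ then $t_{\mathcal{G}}(\lambda)$ is a sharp DP-threshold function for $\mathcal{G}$.
   Context: All graphs are finite and simple. $\mathbb{N}=\{0,1,2,\ldots\}$ and $[k]=\{1,\ldots,k\}$. The density of a nonempty graph $G$ is $d(G)=|E(G)|/|V(G)|$; the maximum density is $\rho(G)=\max_{G'} d(G')$, the maximum being over all nonempty subgraphs $G'$ of $G$. A (DP-)cover of a graph $G$ is a pair $\mathcal{H}=(L,H)$ where $H$ is a graph and $L:V(G)\to 2^{V(H)}$ is such that: $\{L(v):v\in V(G)\}$ is a partition of $V(H)$ into $|V(G)|$ independent sets; for each edge $uv\in E(G)$ the edges of $H$ between $L(u)$ and $L(v)$ form a matching; and $H$ has no other edges than those between $L(u)$ and $L(v)$ with $uv\in E(G)$. A transversal is a set $T\subseteq V(H)$ containing exactly one vertex of each $L(v)$; it is independent if it is an independent set in $H$. $G$ is $\mathcal{H}$-colorable if $\mathcal{H}$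 has an independent transversal. For $k\in\mathbb{N}$, the random $k$-fold cover $\mathcal{H}(G,k)=(L,H)$ is defined by $L(v)=\{(v,i):i\in[k]\}$ for $v\in V(G)$ and, independently for each edge $uv\in E(G)$, the edges of $H$ between $L(u)$ and $L(v)$ form a perfect matching chosen uniformly at random among the $k!$ perfect matchings between $L(u)$ and $L(v)$ ($H$ has no other edges). Let $\kappa=(k_\lambda)_{\lambda\in\mathbb{N}}$ be a sequence with $k_\lambda\in\mathbb{N}$. $\mathcal{G}$ is $\kappa$-DP-colorable w.h.p. if $\lim_{\lambda\to\infty}\mathbb{P}(G_\lambda\text{ is }\mathcal{H}(G_\lambda,k_\lambda)\text{-colorable})=1$, and non-$\kappa$-DP-colorable w.h.p. if this limit equals $0$. A function $t_{\mathcal{G}}:\mathbb{N}\to\mathbb{R}$ is a DP-threshold function for $\mathcal{G}$ if for every such $\kappa$: if $k_\lambda=o(t_{\mathcal{G}}(\lambda))$, then $\mathcal{G}$ is non-$\kappa$-DP-colorable w.h.p., while if $t_{\mathcal{G}}(\lambda)=o(k_\lambda)$, then $\mathcal{G}$ is $\kappa$-DP-colorable w.h.p. ($o(\cdot)$ as $\lambda\to\infty$). It is a sharp DP-threshold function for $\mathcal{G}$ if for any $\varepsilon>0$ and any such $\kappa$: $\mathcal{G}$ is non-$\kappa$-DP-colorable w.h.p. when $k_\lambda\leq(1-\varepsilon)t_{\mathcal{G}}(\lambda)$ for all large enough $\lambda$, and $\mathcal{G}$ is $\kappa$-DP-colorable w.h.p. when $k_\lambda\geq(1+\varepsilon)t_{\mathcal{G}}(\lambda)$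 for all large enough $\lambda$. Only large $\lambda$ matter, so values of $t_{\mathcal{G}}$ at the finitely many indices where the given formula is undefined may be chosen arbitrarily. *)

(* Defs.v *)
(* Finite graphs, DP-covers and random k-fold covers, over MathComp and
   MathComp-Analysis. *)
From mathcomp Require Import all_boot all_order all_algebra.
From mathcomp Require Import all_classical all_reals all_analysis.

Set Implicit Arguments.
Unset Strict Implicit.
Unset Printing Implicit Defensive.

Import Order.TTheory GRing.Theory Num.Theory.
Import numFieldNormedType.Exports.

Local Open Scope classical_set_scope.
Local Open Scope ring_scope.

Record sgraph := SGraph {
  vertex :> finType;
  adj : rel vertex;
  adj_sym : symmetric adj;
  adj_irrefl : irreflexive adj }.

Definition edges (G : sgraph) : {set {set G}} :=
  [set e | [exists u, exists v, adj u v && (e == [set u; v]%SET)]]%SET.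

(* A subgraph (A, F), not necessarily induced, with vertex set A and edge
   set F. *)
Definition subgraph (G : sgraph) (S : {set G} * {set {set G}}) : bool :=
  (S.2 \subset edges G) && [forall e in S.2, e \subset S.1].

Definition density (R : realType) (G : sgraph)
    (S : {set G} * {set {set G}}) : R :=
  #|S.2|%:R / #|S.1|%:R.

(* Densities are nonnegative, so the default value 0 is harmless: it only
   matters for the graph with no vertices. *)
Definition maxdensity (R : realType) (G : sgraph) : R :=
  \big[Num.max/0]_(S : {set G} * {set {set G}} |
                     subgraph S && (S.1 != finset.set0)) density R S.

Definition independent (H : sgraph) (T : {set H}) : bool :=
  [forall x in T, forall y in T, ~~ adj x y].

(* Parts L v may be empty: the 0-fold cover has only empty parts. *)
Definition is_cover (G H : sgraph) (L : G -> {set H}) : Prop :=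
  [/\ forall x : H, exists! v : G, x \in L v,
      forall v, independent (L v),
      forall u v, adj u v -> forall x, x \in L u ->
        (#|[set y in L v | adj x y]%SET| <= 1)%N
    & forall x y : H, adj x y ->
        exists u v : G, [/\ adj u v, x \in L u & y \in L v]].

Definition transversal (G H : sgraph) (L : G -> {set H}) (T : {set H}) : bool :=
  [forall v, #|T :&: L v| == 1%N].

Definition cover_colorable (G H : sgraph) (L : G -> {set H}) : bool :=
  [exists T : {set H}, transversal L T && independent T].

(* For e = {u, v}: M is a set of pairs {x, y} with x over u and y over v
   covering each vertex lying over u or v exactly once. *)
Definition perfect_matching (G : sgraph) (k : nat) (e : {set G})
    (M : {set {set G * 'I_k}}) : bool :=
  [forall f in M, (#|f| == 2%N) && (fst @: f == e)]
  && [forall x : G * 'I_k, (x.1 \in e) ==> (#|[set f in M | x \in f]%SET| == 1%N)].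

(* Joint outcomes w of the random matchings: w e is a perfect matching for each
   edge e of G; outside edges G, w takes the dummy value set0. *)
Definition matching_choices (G : sgraph) (k : nat) :
    {set {ffun {set G} -> {set {set G * 'I_k}}}} :=
  [set w in pfamily finset.set0 (mem (edges G)) (fun e => perfect_matching (k := k) e)]%SET.

Section KFold.
Variables (G : sgraph) (k : nat) (w : {ffun {set G} -> {set {set G * 'I_k}}}).

Definition kfold_adj : rel (G * 'I_k)%type := fun x y =>
  (x != y) && ([set x; y]%SET \in w [set x.1; y.1]%SET).

Lemma kfold_adj_sym : symmetric kfold_adj.
Proof.
by move=> x y; rewrite /kfold_adj eq_sym finset.setUC [[set x.1; _]%SET]finset.setUC.
Qed.

Lemma kfold_adj_irrefl : irreflexive kfold_adj.
Proof. by move=> x; rewrite /kfold_adj eqxx. Qed.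

Definition kfold_graph : sgraph := SGraph kfold_adj_sym kfold_adj_irrefl.

Definition kfold_list (v : G) : {set kfold_graph} :=
  [set x : G * 'I_k | x.1 == v]%SET.

Lemma kfold_is_cover : w \in matching_choices G k -> is_cover kfold_list.
Proof.
rewrite inE => /pfamilyP [w0 wE].
have adjP (x y : G * 'I_k) : kfold_adj x y ->
    [/\ x != y, adj x.1 y.1, [set x; y]%SET \in w [set x.1; y.1]%SET
      & perfect_matching [set x.1; y.1]%SET (w [set x.1; y.1]%SET)].
  case/andP=> xy xyw; have eE : [set x.1; y.1]%SET \in edges G.
    by apply: contraTT xyw => /(supportP w0) ->; rewrite inE.
  have /= pm := wE _ eE; split=> //.
  have /andP[/forall_inP /(_ _ xyw)/andP[_ _] _] := pm.
  move: eE; rewrite inE => /existsP[u] /existsP[v] /andP[uv /eqP exy].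
  have : u \in [set x.1; y.1]%SET by rewrite exy !inE eqxx.
  have : v \in [set x.1; y.1]%SET by rewrite exy !inE eqxx orbT.
  rewrite !inE; case/orP=> /eqP ev; case/orP=> /eqP eu; subst u v => //.
  - by rewrite adj_irrefl in uv.
  - by rewrite adj_sym.
  - by rewrite adj_irrefl in uv.
split.
- by move=> x; exists x.1; split=> [|v]; rewrite inE // => /eqP.
- move=> v; apply/forall_inP => x; rewrite inE => /eqP xv.
  apply/forall_inP => y; rewrite inE => /eqP yv.
  by apply/negP => /adjP[_]; rewrite xv yv adj_irrefl.
- move=> u v uv x; rewrite inE => /eqP xu.
  apply/card_le1_eqP => y z; rewrite !inE.
  move=> /andP[/eqP yv /adjP[xy _ ywx pm]] /andP[/eqP zv /adjP[xz _ zwx _]].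
  rewrite yv in ywx pm; rewrite zv in zwx.
  have /andP[_ /forallP /(_ x)] := pm.
  rewrite !inE eqxx /= => /cards1P[f fE].
  have : [set x; y]%SET \in [set f]%SET by rewrite -fE !inE ywx eqxx.
  have : [set x; z]%SET \in [set f]%SET by rewrite -fE !inE zwx eqxx.
  rewrite !inE => /eqP <- /eqP /setP /(_ y).
  by rewrite !inE eqxx orbT eq_sym (negbTE xy) /= => /esym /eqP.
- by move=> x y /adjP[_ xy _ _]; exists x.1, y.1; rewrite !inE !eqxx.
Qed.

End KFold.

(* The law of the random cover is the product, over the edges e of G, of the
   uniform laws on the perfect matchings for e. *)
Definition colorable_prob (R : realType) (G : sgraph) (k : nat) : R :=
  \sum_(w in matching_choices G k | cover_colorable (kfold_list w))
     \prod_(e in edges G)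
        #|[set M | perfect_matching (k := k) e M]%SET|%:R^-1.

Definition DP_colorable_whp (R : realType) (G : nat -> sgraph)
    (kappa : nat -> nat) : Prop :=
  colorable_prob R (G l) (kappa l) @[l --> \oo] --> (1 : R).

Definition non_DP_colorable_whp (R : realType) (G : nat -> sgraph)
    (kappa : nat -> nat) : Prop :=
  colorable_prob R (G l) (kappa l) @[l --> \oo] --> (0 : R).

Definition DP_threshold (R : realType) (G : nat -> sgraph) (t : nat -> R) :
    Prop :=
  forall kappa : nat -> nat,
    ((fun l => (kappa l)%:R : R^o) =o_\oo (t : nat -> R^o) ->
       non_DP_colorable_whp R G kappa)
    /\ ((t : nat -> R^o) =o_\oo (fun l => (kappa l)%:R : R^o) ->
       DP_colorable_whp R G kappa).

Definition sharp_DP_threshold (R : realType) (G : nat -> sgraph)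
    (t : nat -> R) : Prop :=
  forall (eps : R) (kappa : nat -> nat), 0 < eps ->
    ((\forall l \near \oo, (kappa l)%:R <= (1 - eps) * t l) ->
       non_DP_colorable_whp R G kappa)
    /\ ((\forall l \near \oo, (1 + eps) * t l <= (kappa l)%:R) ->
       DP_colorable_whp R G kappa).

(* Main.v *)
Require Import Defs.
From mathcomp Require Import all_boot all_order all_algebra.
From mathcomp Require Import fingroup perm ring lra reals sequences exp.

(** Write [n] for the number of vertices, [rho] for the maximum density and
    [q = 1 - 1 / k] for the probability that a given colouring is proper on a
    given edge of the random [k]-fold cover. Different edges are independent.

    Non-colourability is a first-moment bound on a densest subgraph, with [s]
    vertices and [rho s] edges. It has [k ^ s * q ^ (rho s)] proper colourings on
    average, at most [expR (s * (ln k - rho / k))], and this tends to 0 when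
    [k <= (1 - eps) rho / ln rho] ([colorable_prob_le_first_moment]).

    For the threshold, colour greedily. Every induced subgraph has a vertex of
    degree at most [2 rho], so there is an order in which each vertex has at most
    [d <= 2 rho] earlier neighbours, whose matchings are still unrevealed when the
    vertex is reached. Each of them forbids a uniform colour, independently, so
    the vertex gets stuck only if [d] coupons fill a collection of size [k], and
    this has probability at most [(1 - q ^ d) ^ k] ([expect_covered]). For
    [k >= 8 rho / ln rho] the list keeps about [k * q ^ d >= rho ^ (1 / 4)]
    free colours on average, which beats [2 ln n] as soon as
    [ln rho >= 8 ln (ln n)], and a union bound over the vertices concludes
    ([colorable_prob_ge_greedy]).

    Greedy colouring loses a constant factor, because the degeneracy can be
    [2 rho]. The sharp threshold uses the second moment of the number [X] of
    proper colourings instead. If two colourings agree exactly on a set [A] of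
    vertices, then an edge is proper for both with probability at most
    [q ^ 2 (1 + (k - 1) ^ - 3)], times [1 / q] if it lies inside [A]. Hence
    [E X ^ 2 / (E X) ^ 2] is at most [(1 + (k - 1) ^ - 3) ^ |E|] times the average
    of [q ^ - e(A)] over pairs of colourings. The first factor tends to 1 because
    [|E| <= rho n] is much smaller than [k ^ 3]. In the second, [e(A)] is at most
    [|A| ^ 2] and at most [rho |A|]; the former makes the small sets harmless, and
    the latter, with [rho / k < ln n / (1 + eps / 2)], makes the sets with more
    than [n ^ (1 - b)] elements negligible ([colorable_prob_ge_sharp]). *)

Set Implicit Arguments.
Unset Strict Implicit.
Unset Printing Implicit Defensive.

Import Order.TTheory GRing.Theory Num.Theory.

Local Open Scope ring_scope.

(** * Expectations over finite product spaces *)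

Section ProductExpectation.
Variables (R : realFieldType) (I X : finType) (p : I -> X -> R).
Hypotheses (p_ge0 : forall i x, 0 <= p i x) (p_sum1 : forall i, \sum_x p i x = 1).
Implicit Types (w : {ffun I -> X}) (f g : {ffun I -> X} -> R).

Definition weight w : R := \prod_i p i (w i).

Definition expect f : R := \sum_w weight w * f w.

Lemma weight_ge0 w : 0 <= weight w.
Proof. by apply: prodr_ge0. Qed.

Lemma expect_prod (F : I -> X -> R) :
  expect (fun w => \prod_i F i (w i)) = \prod_i \sum_x p i x * F i x.
Proof.
by rewrite bigA_distr_bigA; apply: eq_bigr => w _; rewrite big_split.
Qed.

Lemma expect_cst (a : R) : expect (fun=> a) = a.
Proof.
by rewrite /expect -mulr_suml -(bigA_distr_bigA p) big1 ?mul1r.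
Qed.

Lemma expectD f g : expect (fun w => f w + g w) = expect f + expect g.
Proof. by rewrite -big_split; apply: eq_bigr => w _; rewrite mulrDr. Qed.

Lemma expectZ (a : R) f : expect (fun w => a * f w) = a * expect f.
Proof. by rewrite /expect mulr_sumr; apply: eq_bigr => w _; rewrite mulrCA. Qed.

Lemma expect_sum (J : finType) (P : pred J) (F : J -> {ffun I -> X} -> R) :
  expect (fun w => \sum_(j | P j) F j w) = \sum_(j | P j) expect (F j).
Proof. by rewrite exchange_big; apply: eq_bigr => w _; rewrite mulr_sumr. Qed.

Lemma eq_expect f g : f =1 g -> expect f = expect g.
Proof. by move=> fg; apply: eq_bigr => w _; rewrite fg. Qed.

Lemma le_expect f g : (forall w, weight w != 0 -> f w <= g w) ->
  expect f <= expect g.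
Proof.
move=> fg; apply: ler_sum => w _.
have [->|w0] := eqVneq (weight w) 0; first by rewrite !mul0r.
by rewrite ler_wpM2l ?weight_ge0 ?fg.
Qed.

Lemma expect_ge0 f : (forall w, 0 <= f w) -> 0 <= expect f.
Proof. by move=> f0; apply: sumr_ge0 => w _; rewrite mulr_ge0 ?weight_ge0. Qed.

Lemma weight_neq0 w i : weight w != 0 -> p i (w i) != 0.
Proof. by move=> /prodf_neq0 /(_ i); exact. Qed.

(** Swapping the coordinates in [A] between two independent copies of the
    product space preserves its measure; this turns the product of the two
    expectations into the expectation of the product. *)
Lemma expect_indep (A : {set I}) f g :
  (forall w w', {in A, w =1 w'} -> f w = f w') ->
  (forall w w', {in ~: A, w =1 w'} -> g w = g w') ->
  expect (fun w => f w * g w) = expect f * expect g.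
Proof.
move=> fA gA.
pose mix (u v : {ffun I -> X}) := [ffun i => if i \in A then u i else v i].
pose swap (u : {ffun I -> X} * {ffun I -> X}) := (mix u.1 u.2, mix u.2 u.1).
have mixK u v : mix (mix u v) (mix v u) = u.
  by apply/ffunP => i; rewrite !ffunE; case: (i \in A).
have swapK : involutive swap by case=> u v; rewrite /swap /= !mixK.
have weight_mix u v : weight (mix u v) * weight (mix v u) = weight u * weight v.
  rewrite -!big_split; apply: eq_bigr => i _; rewrite !ffunE /=.
  by case: ifP => _ //; rewrite mulrC.
have -> : expect f * expect g =
    \sum_u \sum_v weight u * f u * (weight v * g v) by rewrite /expect big_distrlr.
rewrite pair_big /= (reindex_inj (inv_inj swapK)) /=.
transitivity (\sum_(u : {ffun I -> X} * {ffun I -> X})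
   weight u.1 * weight u.2 * (f u.1 * g u.1)); last first.
  apply: eq_bigr => -[u v] _ /=.
  have -> : f (mix u v) = f u by apply: fA => i iA; rewrite ffunE iA.
  have -> : g (mix v u) = g u.
    by apply: gA => i; rewrite inE ffunE => /negbTE ->.
  by rewrite -weight_mix mulrACA.
rewrite -(pair_big xpredT xpredT
  (fun u v => weight u * weight v * (f u * g u))) /=.
apply: eq_bigr => u _; rewrite -[LHS]mul1r -(expect_cst 1) /expect !mulr_suml.
by apply: eq_bigr => v _; rewrite mulr1; ring.
Qed.

(** Since [(1 - l f) ^ 2 >= 0], the indicator of [f != 0] is at least
    [2 l f - l ^ 2 f ^ 2] for every real [l]. Taking expectations with
    [l = 1 / expect f] replaces the Cauchy-Schwarz inequality. *)
Lemma second_moment (B : {ffun I -> X} -> bool) f : expect f != 0 ->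
  (forall w, weight w != 0 -> ~~ B w -> f w = 0) ->
  2 - expect (fun w => f w ^+ 2) / expect f ^+ 2 <=
  expect (fun w => (B w)%:R).
Proof.
move=> f0 fB; set l := (expect f)^-1.
apply: (@le_trans _ _ (expect (fun w => (2 * l) * f w + (- l ^+ 2) * f w ^+ 2))).
  rewrite expectD !expectZ mulNr [_ / _]mulrC exprVn lerD2r -mulrA.
  by rewrite mulVf // mulr1.
apply: le_expect => w w0; case: (boolP (B w)) => [_|/(fB _ w0) ->].
  by rewrite -subr_ge0 (_ : _ - _ = (1 - l * f w) ^+ 2) ?sqr_ge0 //=; ring.
by rewrite expr0n /= !mulr0 addr0.
Qed.

End ProductExpectation.

(** Convexity of [y ^ (j + 1)], in the homogeneous form of Bernoulli's
    inequality. *)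
Lemma bernoulli_convex (R : realFieldType) (y h : R) (j : nat) : 0 <= y -> 0 <= h ->
  y ^+ j.+1 + j.+1%:R * h * y ^+ j <= (y + h) ^+ j.+1.
Proof.
move=> y0 h0; elim: j => [|j IH]; first by rewrite !expr1 expr0 mulr1 mul1r.
rewrite [leRHS]exprS; apply: (le_trans _ (ler_wpM2l (addr_ge0 y0 h0) IH)).
have : 0 <= h * (j.+1%:R * h * y ^+ j) by rewrite !mulr_ge0 ?exprn_ge0.
move=> h2; rewrite -subr_ge0; apply: le_trans h2 _; rewrite le_eqVlt.
by apply/orP; left; apply/eqP; rewrite -(natr1 j.+1) !exprS; ring.
Qed.

Section Covering.
Variables (R : realFieldType) (I X : finType) (p : I -> X -> R).
Hypotheses (p_ge0 : forall i x, 0 <= p i x) (p_sum1 : forall i, \sum_x p i x = 1).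
Variables (k : nat) (hit : I -> X -> 'I_k -> bool) (N : {set I}).
Hypothesis hit_inj : forall i x a b, i \in N -> p i x != 0 ->
  hit i x a -> hit i x b -> a = b.
Hypothesis hit_unif : forall i a, i \in N ->
  \sum_x p i x * (hit i x a)%:R = k%:R^-1.

Definition covered (M : {set I}) (J : {set 'I_k}) (w : {ffun I -> X}) : bool :=
  [forall a in J, exists i in M, hit i (w i) a].

(** Coupon collector: the events that the various colours are hit are
    negatively correlated. Revealing the colour hit by one coordinate [i] gives
    a recursion in which the bound is preserved by Bernoulli's inequality. *)
Lemma expect_covered (J : {set 'I_k}) : (0 < k)%N ->
  expect p (fun w => (covered N J w)%:R) <=
  (1 - (1 - k%:R^-1) ^+ #|N|) ^+ #|J|.
Proof.
move=> k0.
have k0R : (0 : R) < k%:R by rewrite ltr0n.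
have q0 : (0 : R) <= 1 - k%:R^-1.
  by rewrite subr_ge0 invf_le1 // ler1n.
have q1 : (1 : R) - k%:R^-1 <= 1 by rewrite lerBlDr lerDl invr_ge0 ler0n.
suff H n (M : {set I}) (K : {set 'I_k}) : M \subset N -> #|M| = n ->
    expect p (fun w => (covered M K w)%:R) <= (1 - (1 - k%:R^-1) ^+ n) ^+ #|K|.
  exact: (H #|N|).
elim: n M K => [|n IH] M K MN cM.
  have -> : M = set0 by apply: cards0_eq.
  rewrite expr0 subrr expr0n cards_eq0 -[leRHS](expect_cst p_sum1).
  apply: le_expect => // w _; rewrite ler_nat.
  case: (set_0Vmem K) => [->|[a aK]]; first by rewrite eqxx leq_b1.
  suff -> : covered set0 K w = false by [].
  by apply/negP => /forall_inP/(_ a aK)/exists_inP[i]; rewrite inE.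
have [i iM] : exists i, i \in M by apply/set0Pn; rewrite -cards_eq0 cM.
have iN := subsetP MN _ iM.
have cM' : #|M :\ i| = n by apply/eqP; rewrite -eqSS -cM (cardsD1 i M) iM.
have MN' : M :\ i \subset N by rewrite (subset_trans _ MN) ?subsetDl.
set y : R := 1 - _ ^+ n in IH.
have dep (L : {set 'I_k}) (w w' : {ffun I -> X}) : {in ~: [set i], w =1 w'} ->
    ((covered (M :\ i) L w)%:R : R) = (covered (M :\ i) L w')%:R.
  move=> ww'; congr (nat_of_bool _)%:R; apply: eq_forallb_in => a _.
  by apply: eq_existsb_in => j /setD1P[ji _]; rewrite ww' ?inE.
have hitE a : expect p (fun w => (hit i (w i) a)%:R) = k%:R^-1.
  have := @expect_prod _ _ _ p (fun j x => if j == i then (hit i x a)%:R else 1).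
  rewrite (bigD1 i) //= eqxx hit_unif // big1 ?mulr1; last first.
    move=> j /negbTE ->; rewrite -[RHS](p_sum1 j).
    by apply: eq_bigr => x _; rewrite mulr1.
  move=> <-; apply: eq_expect => w; rewrite (bigD1 i) //= eqxx big1 ?mulr1 //.
  by move=> j /negbTE ->.
pose none (w : {ffun I -> X}) : bool := [forall a in K, ~~ hit i (w i) a].
have noneE : expect p (fun w => (none w)%:R) = 1 - #|K|%:R / k%:R.
  apply/eqP; rewrite -subr_eq0 opprB addrA subr_eq0; apply/eqP.
  rewrite mulr_natl -sumr_const.
  rewrite -(eq_bigr _ (fun a _ => hitE a)) -(expect_sum p (mem K)).
  rewrite -expectD -[RHS](expect_cst p_sum1).
  rewrite /expect; apply: eq_bigr => w _.
  have [->|w0] := eqVneq (weight p w) 0; first by rewrite !mul0r.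
  congr (_ * _); have [n1|] := boolP (none w).
    by rewrite big1 ?addr0 // => a /(forall_inP n1)/negbTE ->.
  rewrite /none negb_forall_in => /exists_inP[a aK /negPn ha].
  rewrite (bigD1 a) //= ha big1 ?add0r ?addr0 // => b /andP[bK ba].
  case: (boolP (hit i (w i) b)) => // hb; move: ba.
  by rewrite (hit_inj iN (weight_neq0 i w0) hb ha) eqxx.
(* Either [i] hits some [a] in [K], and the rest of [M] covers [K :\ a], or [i]
   hits nothing in [K], and the rest of [M] covers [K]. *)
apply: (@le_trans _ _ (expect p (fun w =>
    \sum_(a in K) (hit i (w i) a)%:R * (covered (M :\ i) (K :\ a) w)%:R
    + (none w)%:R * (covered (M :\ i) K w)%:R))).
  apply: le_expect => // w w0; have [cov|_] := boolP (covered M K w); last first.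
    by rewrite addr_ge0 ?sumr_ge0 // => *; rewrite mulr_ge0.
  have [n1|] := boolP (none w).
    suff -> : covered (M :\ i) K w.
      by rewrite mulr1 lerDr sumr_ge0 // => *; rewrite mulr_ge0.
    apply/forall_inP => a aK; have /exists_inP[j jM hj] := forall_inP cov a aK.
    apply/exists_inP; exists j => //; rewrite !inE jM andbT.
    by apply: contraTneq hj => ->; apply: (forall_inP n1).
  rewrite /none negb_forall_in => /exists_inP[a aK /negPn ha].
  rewrite mul0r addr0 (bigD1 a) //= ha mul1r.
  suff -> : covered (M :\ i) (K :\ a) w.
    by rewrite lerDl sumr_ge0 // => *; rewrite mulr_ge0.
  apply/forall_inP => b /setD1P[ba bK].
  have /exists_inP[j jM hj] := forall_inP cov b bK.
  apply/exists_inP; exists j => //; rewrite !inE jM andbT.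
  apply: contraNneq ba => ji; rewrite ji in hj.
  by rewrite (hit_inj iN (weight_neq0 i w0) hj ha).
have indepR (B : {ffun I -> X} -> bool) L :
    (forall w w' : {ffun I -> X}, w i = w' i -> B w = B w') ->
    expect p (fun w => (B w)%:R * (covered (M :\ i) L w)%:R) =
    expect p (fun w => (B w)%:R) * expect p (fun w => (covered (M :\ i) L w)%:R).
  move=> Bi; apply: (expect_indep p_sum1 (A := [set i])); last exact: dep.
  by move=> w w' ww'; rewrite (Bi _ w') // ww' // inE.
rewrite expectD (expect_sum p (mem K)) indepR; last first.
  by move=> w w' ww'; rewrite /none ww'.
rewrite noneE.
have revealE a L :
    expect p (fun w => (hit i (w i) a)%:R * (covered (M :\ i) L w)%:R) =
    k%:R^-1 * expect p (fun w => (covered (M :\ i) L w)%:R).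
  by rewrite (indepR (fun w => hit i (w i) a)) ?hitE // => w w' ->.
under eq_bigr => a _ do rewrite revealE.
have y0 : 0 <= y by rewrite subr_ge0 exprn_ile1.
have yS : 1 - (1 - k%:R^-1) ^+ n.+1 = y + (1 - k%:R^-1) ^+ n / k%:R.
  by rewrite /y exprS; ring.
have jk : #|K|%:R / k%:R <= 1 :> R.
  by rewrite ler_pdivrMr // mul1r ler_nat (leq_trans (max_card _)) ?card_ord.
rewrite yS; have [K0|[b bK]] := set_0Vmem K.
  rewrite K0 big_set0 cards0 mul0r subr0 expr0 add0r mul1r.
  by apply: le_trans (IH _ _ MN' cM') _; rewrite cards0 expr0.
have cK : #|K| = #|K :\ b|.+1 by rewrite (cardsD1 b K) bK.
have {}IHa a : a \in K -> expect p (fun w => (covered (M :\ i) (K :\ a) w)%:R) <=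
   y ^+ #|K :\ b|.
  move=> aK; apply: le_trans (IH _ _ MN' cM') _.
  suff -> : #|K :\ a| = #|K :\ b| by [].
  by apply/eqP; rewrite -eqSS -cK (cardsD1 a K) aK.
apply: (@le_trans _ _ (\sum_(a in K) k%:R^-1 * y ^+ #|K :\ b| +
    (1 - #|K|%:R / k%:R) * y ^+ #|K|)).
  apply: lerD; last by rewrite ler_wpM2l ?subr_ge0 ?IH.
  by apply: ler_sum => a aK; rewrite ler_wpM2l ?invr_ge0 ?ler0n ?IHa.
rewrite sumr_const cK -[X in X + _]mulr_natl.
apply: le_trans (bernoulli_convex #|K :\ b| y0 _); last first.
  by rewrite divr_ge0 ?exprn_ge0 ?ler0n.
by rewrite exprS le_eqVlt; apply/orP; left; apply/eqP; rewrite /y; field; rewrite gt_eqF.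
Qed.

End Covering.

(** * Random perfect matchings over one edge *)

Lemma card_sep_sum (T : finType) (A : {set T}) (P : pred T) :
  #|[set x in A | P x]| = (\sum_(x in A) P x)%N.
Proof.
by rewrite -sum1dep_card big_mkcondr; apply: eq_bigr => x _; case: (P x).
Qed.

Section PerfectMatchings.
Variables (G : sgraph) (k : nat) (u v : G) (uv : u != v).
Implicit Types (i j a b : 'I_k) (M : {set {set G * 'I_k}}).

Local Notation pm := (perfect_matching (k := k) [set u; v]).
Local Notation matchings := [set M | pm M].

Definition link i j : {set G * 'I_k} := [set (u, i); (v, j)].

Lemma link_inj i j i' j' : link i j = link i' j' -> i = i' /\ j = j'.
Proof.
move=> E; split.
  have : (u, i) \in link i' j' by rewrite -E !inE eqxx.
  by rewrite !inE !xpair_eqE (negbTE uv) eqxx /= orbF => /eqP.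
have : (v, j) \in link i' j' by rewrite -E !inE eqxx orbT.
by rewrite !inE !xpair_eqE [v == u]eq_sym (negbTE uv) eqxx /= => /eqP.
Qed.

Lemma in_link i j x : (x \in link i j) = (x == (u, i)) || (x == (v, j)).
Proof. by rewrite !inE. Qed.

Lemma card_link i j : #|link i j| = 2.
Proof. by rewrite cards2 xpair_eqE negb_and uv. Qed.

Lemma fst_link i j : fst @: link i j = [set u; v].
Proof. by rewrite imsetU !imset_set1. Qed.

Lemma link_endpoints (f : {set G * 'I_k}) :
  #|f| == 2 -> fst @: f == [set u; v] -> exists i j, f = link i j.
Proof.
move=> /cards2P[x [y [_ ->]]] /eqP; rewrite imsetU !imset_set1 => E.
have xuv : x.1 \in [set u; v] by rewrite -E !inE eqxx.
have yuv : y.1 \in [set u; v] by rewrite -E !inE eqxx orbT.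
have uxy : u \in [set x.1; y.1] by rewrite E !inE eqxx.
have vxy : v \in [set x.1; y.1] by rewrite E !inE eqxx orbT.
case: x y xuv yuv uxy vxy {E} => [x i] [y j]; rewrite !inE /=.
case/orP=> /eqP->; case/orP=> /eqP->; rewrite ?orbb ?eqxx ?(negbTE uv) //=.
- by move=> _; rewrite eq_sym (negbTE uv).
- by move=> _ _; exists i, j.
- by move=> _ _; exists j, i; rewrite /link setUC.
Qed.

Lemma pm_link M f : pm M -> f \in M -> exists i j, f = link i j.
Proof.
by case/andP=> /forall_inP H _ /H /andP[]; apply: link_endpoints.
Qed.

Lemma pm_unique M x f g : pm M -> x.1 \in [set u; v] ->
  f \in M -> g \in M -> x \in f -> x \in g -> f = g.
Proof.
move=> /andP[_ /forallP/(_ x)/implyP H] /H /cards1P[h hE] fM gM xf xg.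
have : f \in [set h] by rewrite -hE inE fM.
have : g \in [set h] by rewrite -hE inE gM.
by rewrite !inE => /eqP-> /eqP.
Qed.

Lemma pm_left_inj M i j j' : pm M -> link i j \in M -> link i j' \in M -> j = j'.
Proof.
move=> pmM H H'; suff /link_inj[] : link i j = link i j' by [].
by apply: (pm_unique (x := (u, i)) pmM) => //; rewrite !inE eqxx.
Qed.

Lemma pm_right_inj M i i' j : pm M -> link i j \in M -> link i' j \in M -> i = i'.
Proof.
move=> pmM H H'; suff /link_inj[] : link i j = link i' j by [].
by apply: (pm_unique (x := (v, j)) pmM) => //; rewrite !inE eqxx orbT.
Qed.

Lemma pm_left_total M i : pm M -> exists j, link i j \in M.
Proof.
move=> pmM; have /andP[_ /forallP/(_ (u, i))] := pmM.
rewrite !inE eqxx /= => /cards1P[f /setP/(_ f)]; rewrite !inE eqxx.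
case/andP=> fM; have [i' [j fE]] := pm_link pmM fM; rewrite fE in fM *.
rewrite !inE !xpair_eqE (negbTE uv) eqxx /= orbF => /eqP->.
by exists j.
Qed.

Lemma pm_exists : exists M, pm M.
Proof.
exists [set link i i | i : 'I_k]; apply/andP; split.
  apply/forall_inP => f /imsetP[i _ ->].
  by rewrite card_link fst_link !eqxx.
apply/forallP => -[x i]; apply/implyP; rewrite /= => xuv.
apply/cards1P; exists (link i i); apply/setP => f; rewrite !inE.
apply/andP/eqP => [[/imsetP[j _ ->]]|->].
  rewrite in_link !xpair_eqE; case/orP=> /andP[_ /eqP->] //.
split; first by apply: imset_f.
by rewrite in_link !xpair_eqE eqxx !andbT -in_set2.
Qed.

(** Permuting the colours over [v]. This is a symmetry of the set of perfect
    matchings, and it makes all links at a given vertex equally likely. *)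
Definition recolor (s : {perm 'I_k}) (x : G * 'I_k) : (G * 'I_k)%type :=
  if x.1 == v then (x.1, s x.2) else x.

Definition recolor_pm s M := [set recolor s @: f | f : {set G * 'I_k} in M].

Lemma recolor_fst s x : (recolor s x).1 = x.1.
Proof. by rewrite /recolor; case: ifP. Qed.

Lemma recolorK s : cancel (recolor s) (recolor s^-1%g).
Proof.
by case=> x i; rewrite /recolor /=; case: (boolP (x == v)) => [xv|/negbTE xv] /=; rewrite xv ?permK.
Qed.

Lemma recolor_inj s : injective (recolor s).
Proof. exact: can_inj (recolorK s). Qed.

Lemma recolor_link s i j : recolor s @: link i j = link i (s j).
Proof.
by rewrite imsetU !imset_set1 /recolor /= (negbTE uv) eqxx.
Qed.

Lemma recolor_pm_in s M (f : {set G * 'I_k}) : (recolor s @: f \in recolor_pm s M) = (f \in M).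
Proof. by rewrite mem_imset //; apply/imset_inj/recolor_inj. Qed.

Lemma recolor_pm_inj s : injective (recolor_pm s).
Proof. by apply/imset_inj/imset_inj/recolor_inj. Qed.

Lemma recolor_pmP s M : pm M -> pm (recolor_pm s M).
Proof.
move=> pmM; apply/andP; split.
  apply/forall_inP => f /imsetP[g /(pm_link pmM)[i [j ->]] ->].
  by rewrite recolor_link card_link fst_link !eqxx.
apply/forallP => x; apply/implyP => xuv.
pose y := recolor s^-1%g x.
have xE : x = recolor s y.
  by rewrite /y -{1}(recolorK s^-1%g x) invgK.
have yuv : y.1 \in [set u; v] by rewrite recolor_fst.
have /andP[_ /forallP/(_ y)/implyP/(_ yuv)/cards1P[f /setP fE]] := pmM.
apply/cards1P; exists (recolor s @: f); apply/setP => g; rewrite inE [RHS]inE.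
apply/andP/eqP => [[/imsetP[h hM ->]]|->].
  rewrite xE mem_imset; last exact: recolor_inj.
  by move=> yh; have := fE h; rewrite !inE hM yh => /esym/eqP->.
have := fE f; rewrite !inE eqxx => /andP[fM yf].
by rewrite recolor_pm_in fM xE imset_f.
Qed.

Lemma card_pm_le s (P Q : pred {set {set G * 'I_k}}) :
  (forall M, pm M -> P M -> Q (recolor_pm s M)) ->
  (#|[set M in matchings | P M]| <= #|[set M in matchings | Q M]|)%N.
Proof.
move=> PQ; rewrite -(card_imset _ (@recolor_pm_inj s)); apply/subset_leq_card.
apply/subsetP => _ /imsetP[M + ->]; rewrite !inE => /andP[pmM /(PQ _ pmM) ->].
by rewrite recolor_pmP.
Qed.

(** All [k] links at [(u, i)] are equally likely and exactly one of them occurs. *)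
Lemma card_pm_link i j :
  (#|[set M in matchings | link i j \in M]| * k)%N = #|matchings|.
Proof.
rewrite [RHS](_ : _ = \sum_(M in matchings) \sum_j (link i j \in M))%N; last first.
  rewrite -sum1_card; apply: eq_bigr => M; rewrite inE => pmM.
  have [j0 j0M] := pm_left_total i pmM.
  rewrite (bigD1 j0) //= j0M big1 // => j' j'j0; apply/eqP.
  by rewrite eqb0; apply: contra j'j0 => /(pm_left_inj pmM j0M) ->.
rewrite exchange_big /=.
set N := #|[set M in matchings | link i j \in M]|.
have -> : (N * k = \sum_(b < k) N)%N.
  by rewrite sum_nat_const card_ord mulnC.
rewrite {}/N.
apply: eq_bigr => j' _; rewrite -card_sep_sum; apply/eqP; rewrite eqn_leq.
have le a b : (#|[set M in matchings | link i a \in M]| <=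
               #|[set M in matchings | link i b \in M]|)%N.
  apply: (@card_pm_le (tperm a b)) => M _.
  by rewrite -(recolor_pm_in (tperm a b) M) recolor_link tpermL.
by rewrite !le.
Qed.

(** Given the link at [(u, i)], the permutations fixing [j] show that the other
    [k - 1] colours over [v] are equally likely for [(u, i')]. *)
Lemma card_pm_link2 i j i' j' : i != i' -> j != j' ->
  (#|[set M in matchings | (link i j \in M) && (link i' j' \in M)]|
    * (k * k.-1))%N = #|matchings|.
Proof.
move=> ii' jj'; rewrite -(card_pm_link i j) mulnA -mulnAC mulnC [RHS]mulnC.
congr (_ * _)%N.
rewrite [RHS](_ : _ = \sum_(M in [set M in matchings | link i j \in M])
    \sum_(b | b != j) (link i' b \in M))%N; last first.
  rewrite -sum1_card; apply: eq_bigr => M; rewrite !inE => /andP[pmM ijM].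
  have [b bM] := pm_left_total i' pmM.
  have bj : b != j.
    apply: contraNneq ii' => bj; rewrite bj in bM.
    by rewrite (pm_right_inj pmM ijM bM).
  rewrite (bigD1 b) //= bM big1 // => c /andP[_ cb]; apply/eqP.
  by rewrite eqb0; apply: contra cb => /(pm_left_inj pmM bM) ->.
rewrite exchange_big /=; set N := #|[set M in matchings | _ && _]|.
have -> : (N * k.-1 = \sum_(b | b != j) N)%N.
  by rewrite sum_nat_const -[in k.-1](card_ord k) -(cardC1 j) mulnC.
rewrite {}/N.
apply: eq_bigr => b bj.
have -> : (\sum_(M in [set M in matchings | link i j \in M]) (link i' b \in M) =
           #|[set M in matchings | (link i j \in M) && (link i' b \in M)]|)%N.
  by rewrite -card_sep_sum; apply: eq_card => M; rewrite !inE andbA.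
have le a c : a != j -> c != j ->
    (#|[set M in matchings | (link i j \in M) && (link i' a \in M)]| <=
     #|[set M in matchings | (link i j \in M) && (link i' c \in M)]|)%N.
  move=> aj cj; apply: (@card_pm_le (tperm a c)) => M _.
  have tj : tperm a c j = j by rewrite tpermD.
  rewrite -(recolor_pm_in (tperm a c) M (link i j)).
  by rewrite -(recolor_pm_in (tperm a c) M (link i' a)) !recolor_link tj tpermL.
by apply/eqP; rewrite eqn_leq !le // eq_sym.
Qed.

End PerfectMatchings.

(** * The law of the random cover *)

Lemma edgesP (G : sgraph) (e : {set G}) :
  reflect (exists u v, [/\ adj u v, u != v & e = [set u; v]]) (e \in edges G).
Proof.
rewrite inE; apply: (iffP existsP) => [[u /existsP[v /andP[uv /eqP->]]]|].
  exists u, v; split=> //; apply: contraTneq uv => ->.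
  by rewrite adj_irrefl.
by move=> [u [v [uv _ ->]]]; exists u; apply/existsP; exists v; rewrite uv eqxx.
Qed.

Section EdgeLaw.
Variables (R : realFieldType) (G : sgraph) (k : nat).
Implicit Types (e : {set G}) (M : {set {set G * 'I_k}}) (c : {ffun G -> 'I_k}).

Local Notation matchings e := [set M | perfect_matching (k := k) e M].

(** Off the edges this is the point mass at [set0], so that the product over all
    sets [e] is a probability weight on the space that the covers live in. *)
Definition pm_weight e M : R :=
  if e \in edges G then (perfect_matching e M)%:R / #|matchings e|%:R
  else (M == set0)%:R.

Definition graph_over c e : {set G * 'I_k} := [set (v, c v) | v in e].

Lemma graph_over2 c u v : graph_over c [set u; v] = link u v (c u) (c v).
Proof. by rewrite /graph_over imsetU !imset_set1. Qed.

Lemma eq_graph_over c c' e : {in e, c =1 c'} -> graph_over c e = graph_over c' e.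
Proof. by move=> cc'; apply: eq_in_imset => x /cc' ->. Qed.

Lemma matchings_gt0 e : e \in edges G -> (0 < #|matchings e|)%N.
Proof.
case/edgesP=> u [v [_ uv ->]]; have [M pmM] := pm_exists k uv.
by apply/card_gt0P; exists M; rewrite inE.
Qed.

Lemma pm_weight_ge0 e M : 0 <= pm_weight e M.
Proof. by rewrite /pm_weight; case: ifP; rewrite ?divr_ge0. Qed.

Lemma pm_weight_event e (P : pred {set {set G * 'I_k}}) : e \in edges G ->
  \sum_M pm_weight e M * (P M)%:R =
  #|[set M in matchings e | P M]|%:R / #|matchings e|%:R.
Proof.
move=> eE; rewrite card_sep_sum natr_sum mulr_suml [RHS]big_mkcond.
apply: eq_bigr => M _; rewrite /pm_weight eE inE.
by case: (perfect_matching e M); rewrite ?mul0r // mul1r mulrC.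
Qed.

Lemma pm_weight_sum1 e : \sum_M pm_weight e M = 1.
Proof.
have [eE|eE] := boolP (e \in edges G).
  under eq_bigr => M _ do rewrite -[pm_weight _ _]mulr1.
  rewrite (pm_weight_event xpredT) // (_ : [set M in _ | _] = matchings e).
    by rewrite divff // pnatr_eq0 -lt0n matchings_gt0.
  by apply/setP => M; rewrite !inE andbT.
rewrite /pm_weight (negbTE eE) (bigD1 set0) //= eqxx big1 ?addr0 // => M.
by move/negbTE->.
Qed.

Lemma pm_weight_neq0 e M : e \in edges G -> pm_weight e M != 0 ->
  perfect_matching e M.
Proof. by rewrite /pm_weight => ->; case: perfect_matching; rewrite ?mul0r ?eqxx. Qed.

Lemma pm_weight_graph_over e c : e \in edges G ->
  \sum_M pm_weight e M * (graph_over c e \in M)%:R = k%:R^-1.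
Proof.
move=> eE; rewrite pm_weight_event //; have := matchings_gt0 eE.
have /edgesP[u [v [_ uv eE']]] := eE; rewrite eE' => m0.
rewrite (eq_card (B := [set M in matchings [set u; v] | link u v (c u) (c v) \in M])).
  have k0 : (0 < k)%N by apply: leq_ltn_trans (ltn_ord (c u)).
  apply: (@mulIf _ k%:R); first by rewrite pnatr_eq0 -lt0n.
  rewrite mulVf ?pnatr_eq0 -?lt0n // mulrAC -natrM card_pm_link //.
  by rewrite divff // pnatr_eq0 -lt0n.
by move=> M; rewrite !inE graph_over2.
Qed.

Lemma pm_weight_avoid e c : e \in edges G ->
  \sum_M pm_weight e M * (graph_over c e \notin M)%:R = 1 - k%:R^-1.
Proof.
move=> eE; rewrite -(pm_weight_graph_over c eE) -[X in X - _](pm_weight_sum1 e) -sumrB.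
by apply: eq_bigr => M _; case: (_ \in M); rewrite /= ?(mulr0, mulr1, subr0, subrr).
Qed.

(** Inclusion-exclusion: two colourings that agree at one end only give
    incompatible links, and if they disagree at both ends then both links occur
    with probability [1 / (k (k - 1))]. *)
Lemma pm_weight_avoid2 e c c' : (1 < k)%N -> e \in edges G ->
  \sum_M pm_weight e M * ((graph_over c e \notin M) && (graph_over c' e \notin M))%:R <=
  (1 - k%:R^-1) ^+ 2 * (1 + (k%:R - 1) ^- 3)
    * (1 - k%:R^-1)^-1 ^+ (e \subset [set v | c v == c' v]).
Proof.
move=> k1 eE.
have k1R : (1 : R) < k%:R by rewrite ltr1n.
have k0R : (0 : R) < k%:R by apply: lt_trans k1R.
have kk0 : (0 : R) < k%:R - 1 by rewrite subr_gt0.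
have q0 : (0 : R) < 1 - k%:R^-1 by rewrite subr_gt0 invf_lt1.
have d1 : (1 : R) <= 1 + (k%:R - 1) ^- 3.
  by rewrite lerDl invr_ge0 exprn_ge0 // ltW.
have incl : \sum_M pm_weight e M * ((graph_over c e \notin M) && (graph_over c' e \notin M))%:R
  = 1 - k%:R^-1 - k%:R^-1 +
    \sum_M pm_weight e M * ((graph_over c e \in M) && (graph_over c' e \in M))%:R.
  rewrite -[1 - _](pm_weight_avoid c eE) -[X in _ - X](pm_weight_graph_over c' eE).
  rewrite -sumrB -big_split; apply: eq_bigr => M _ /=.
  by case: (graph_over c e \in M); case: (graph_over c' e \in M);
    rewrite /= ?(mulr0, mulr1, subr0, sub0r, subrr, addr0, add0r, addNr).
have [agree|] := boolP (e \subset _).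
  have -> : graph_over c' e = graph_over c e.
    by apply: eq_graph_over => x /(subsetP agree); rewrite inE eq_sym => /eqP.
  under eq_bigr => M _ do rewrite andbb.
  rewrite pm_weight_avoid // expr1 mulrAC expr2 mulfK ?gt_eqF //.
  by rewrite ler_peMr // ltW.
move=> disagree; rewrite expr0 mulr1 incl.
have /edgesP[u [v [_ uv eE']]] := eE.
have [cuv|] := boolP ((c u != c' u) && (c v != c' v)).
  case/andP: cuv => cu cv.
  rewrite pm_weight_event //; have := matchings_gt0 eE; rewrite eE' => m0.
  rewrite (eq_card (B := [set M in matchings [set u; v] |
    (link u v (c u) (c v) \in M) && (link u v (c' u) (c' v) \in M)])); last first.
    by move=> M; rewrite !inE !graph_over2.
  rewrite -(card_pm_link2 uv cu cv) natrM invfM mulrA divff; last first.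
    move: m0; rewrite -(card_pm_link2 uv cu cv) muln_gt0 => /andP[m0 _].
    by rewrite pnatr_eq0 -lt0n.
  rewrite natrM -subn1 natrB ?(ltnW k1) // le_eqVlt; apply/orP; left; apply/eqP.
  by field; rewrite !gt_eqF.
rewrite negb_and !negbK => cuv.
rewrite big1 ?addr0; last first.
  move=> M _; have [->|w0] := eqVneq (pm_weight e M) 0; first by rewrite mul0r.
  have := pm_weight_neq0 eE w0; rewrite eE' !graph_over2 => pmM.
  case: (boolP (_ && _)) => [/andP[h h']|_]; last by rewrite mulr0.
  case/negP: disagree; rewrite eE'; apply/subsetP => x; rewrite !inE.
  case/orP: cuv => /eqP E; rewrite -E in h'.
    have Ev := pm_left_inj uv pmM h h'.
    by case/orP=> /eqP ->; rewrite ?E ?Ev.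
  have Eu := pm_right_inj uv pmM h h'.
  by case/orP=> /eqP ->; rewrite ?E ?Eu.
apply: (@le_trans _ _ ((1 - k%:R^-1) ^+ 2)); last first.
  by rewrite ler_peMr // sqr_ge0.
rewrite -subr_ge0 (_ : _ - _ = (k%:R^-1) ^+ 2) ?sqr_ge0 //; ring.
Qed.

End EdgeLaw.

Section Colorings.
Variables (G : sgraph) (k : nat).
Implicit Types (c : {ffun G -> 'I_k}) (E : {set {set G}})
  (w : {ffun {set G} -> {set {set G * 'I_k}}}).

Definition avoids E w c : bool := [forall e in E, graph_over c e \notin w e].

Definition colorable_on E w : bool := [exists c, avoids E w c].

Lemma weight_matching_choices (R : realFieldType) w :
  weight (@pm_weight R G k) w =
  if w \in matching_choices G k
  then \prod_(e in edges G) #|[set M | perfect_matching (k := k) e M]|%:R^-1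
  else 0.
Proof.
rewrite /weight; case: ifPn => wm.
  move: wm; rewrite inE => /pfamilyP[w0 wE].
  rewrite (bigID (mem (edges G))) /= [X in _ * X]big1 ?mulr1; last first.
    move=> e eE; rewrite /pm_weight (negbTE eE).
    by have /(_ e) := subsetP w0; rewrite unfold_in (negbTE eE) /=; case: eqP => // _ /(_ isT).
  apply: eq_bigr => e eE; rewrite /pm_weight eE.
  by have -> : perfect_matching e (w e) := wE e eE; rewrite mul1r.
apply/eqP; rewrite prodf_seq_eq0; apply: contraR wm => /hasPn /= n0.
rewrite inE; apply/pfamilyP; split.
  apply/subsetP => e; rewrite unfold_in; apply: contraR => eE.
  have := n0 e (mem_index_enum e); rewrite /pm_weight (negbTE eE).
  by case: (w e == set0); rewrite ?eqxx.
move=> e eE; have := n0 e (mem_index_enum e); rewrite /= => n0e.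
exact: pm_weight_neq0 eE n0e.
Qed.

Lemma cover_colorableE w : w \in matching_choices G k ->
  cover_colorable (kfold_list w) = colorable_on (edges G) w.
Proof.
rewrite inE => /pfamilyP[w0 wE].
apply/existsP/existsP => [[T /andP[/forallP trT /forall_inP indT]]|[c /forall_inP av]].
  have Tv v : exists x : 'I_k, (v, x) \in T.
    have /cards1P[[y x]] := trT v; move/setP/(_ (y, x)).
    by rewrite !inE eqxx => /andP[yT /= /eqP yv]; exists x; rewrite -yv.
  pose c := [ffun v => xchoose (Tv v)].
  have cT v : (v, c v) \in T by rewrite ffunE; apply: (xchooseP (Tv v)).
  exists c; apply/forall_inP => e eE; apply/negP => cw.
  have /edgesP[u [v [_ uv eE']]] := eE; rewrite eE' graph_over2 in cw.
  have /forall_inP/(_ _ (cT v)) := indT _ (cT u).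
  by rewrite /adj /= /kfold_adj /= cw andbT xpair_eqE negb_and uv.
exists [set x : G * 'I_k | x.2 == c x.1]; apply/andP; split.
  apply/forallP => v; apply/cards1P; exists (v, c v); apply/setP => -[y x].
  rewrite !inE /= xpair_eqE andbC; case: eqP => [->|] //.
apply/forall_inP => -[u i]; rewrite inE /= => /eqP->.
apply/forall_inP => -[v j]; rewrite inE /= => /eqP->.
apply/negP => /andP[xy] /=; rewrite -[[set (u, _); _]]graph_over2.
have [eE|eE] := boolP ([set u; v] \in edges G); first exact/negP/av.
have -> : w [set u; v] = set0 by apply: supportP eE.
by rewrite inE.
Qed.

End Colorings.

(** * First and second moments, greedy colouring *)

Definition edges_in (G : sgraph) (S : {set G}) : {set {set G}} :=
  [set e in edges G | e \subset S].

Section Moments.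
Variables (R : realFieldType) (G : sgraph) (k : nat).
Implicit Types (c : {ffun G -> 'I_k}) (E F : {set {set G}}) (S : {set G})
  (w : {ffun {set G} -> {set {set G * 'I_k}}}).

Local Notation esp := (expect (@pm_weight R G k)).
Local Notation q := (1 - k%:R^-1 : R).
Let pw_ge0 := @pm_weight_ge0 R G k.
Let pw_sum1 := @pm_weight_sum1 R G k.

Lemma avoidsE E w c : (avoids E w c)%:R =
  \prod_e (if e \in E then (graph_over c e \notin w e)%:R else 1) :> R.
Proof.
rewrite -big_mkcond /avoids; case: (boolP [forall e in E, _]) => [/forall_inP av|].
  by rewrite big1 // => e /av ->.
rewrite negb_forall_in => /exists_inP[e eE /negPn ew].
by rewrite (bigD1 e) //= ew mul0r.
Qed.

Lemma expect_avoids E c : E \subset edges G ->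
  esp (fun w => (avoids E w c)%:R) = q ^+ #|E|.
Proof.
move=> EG; under eq_expect => w do rewrite avoidsE.
rewrite (expect_prod _ (fun e (M : {set {set G * 'I_k}}) => if e \in E then (graph_over c e \notin M)%:R else 1)).
rewrite -prodr_const [RHS]big_mkcond; apply: eq_bigr => e _.
case: ifP => [eE|_]; first by rewrite pm_weight_avoid // (subsetP EG).
by under eq_bigr => M _ do rewrite mulr1; apply: pw_sum1.
Qed.

(** A proper colouring of [G] restricts to one of the subgraph [(S, F)]; the
    restrictions are represented with a default colour outside [S]. *)
Lemma expect_colorable_le (S : {set G}) (F : {set {set G}}) :
  (0 < k)%N -> F \subset edges_in S ->
  esp (fun w => (colorable_on (edges G) w)%:R) <= k%:R ^+ #|S| * q ^+ #|F|.
Proof.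
move=> k0 FS; pose a0 : 'I_k := Ordinal k0.
have FG : F \subset edges G.
  by apply/subsetP => e /(subsetP FS); rewrite inE => /andP[].
pose P : pred {ffun G -> 'I_k} := mem (pffun_on a0 (mem S) predT).
apply: (@le_trans _ _ (esp (fun w => \sum_(c | P c) (avoids F w c)%:R))).
  apply: le_expect => // w _.
  case: (boolP (colorable_on _ w)) => [/existsP[c /forall_inP av]|_]; last first.
    exact: sumr_ge0.
  pose c' := [ffun v => if v \in S then c v else a0].
  have c'P : P c'.
    apply/pffun_onP; split=> //; apply/supportP => v vS.
    by rewrite ffunE; move/negbTE: vS => /= ->.
  rewrite (bigD1 c') //= -[leLHS]addr0 lerD ?sumr_ge0 // ler_nat lt0b.
  apply/forall_inP => e eF; rewrite (eq_graph_over (c' := c)) ?av ?(subsetP FG) //.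
  move=> v ve; rewrite ffunE; have := subsetP FS _ eF.
  by rewrite inE => /andP[_ /subsetP/(_ v ve) ->].
rewrite expect_sum (eq_bigr (fun=> q ^+ #|F|)); last first.
  by move=> c _; apply: expect_avoids.
rewrite sumr_const (_ : #|P| = k ^ #|S|)%N; first by rewrite -[leLHS]mulr_natl natrX.
by rewrite card_pffun_on card_ord.
Qed.

Definition agreement c c' : {set G} := [set v | c v == c' v].

Lemma expect_avoids2 c c' : (1 < k)%N ->
  esp (fun w => (avoids (edges G) w c)%:R * (avoids (edges G) w c')%:R) <=
  q ^+ (#|edges G|).*2 * (1 + (k%:R - 1) ^- 3) ^+ #|edges G|
    * q^-1 ^+ #|edges_in (agreement c c')|.
Proof.
move=> k1.
pose F e (M : {set {set G * 'I_k}}) : R := if e \in edges G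
  then ((graph_over c e \notin M) && (graph_over c' e \notin M))%:R else 1.
have FE w : (avoids (edges G) w c)%:R * (avoids (edges G) w c')%:R =
    \prod_e F e (w e).
  rewrite !avoidsE -big_split; apply: eq_bigr => e _; rewrite /F.
  by case: ifP => _ /=; rewrite ?mulr1 // -natrM mulnb.
under eq_expect => w do rewrite FE.
rewrite (expect_prod _ F).
rewrite [leLHS](bigID (mem (edges G))) /= [X in _ * X]big1 ?mulr1; last first.
  move=> e /negbTE eE; rewrite /F eE.
  by under eq_bigr => M _ do rewrite mulr1; apply: pw_sum1.
apply: (@le_trans _ _ (\prod_(e in edges G) (q ^+ 2 * (1 + (k%:R - 1) ^- 3)
    * q^-1 ^+ (e \subset agreement c c')))).
  apply: ler_prod => e eE; rewrite sumr_ge0; last first.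
    by move=> M _; rewrite mulr_ge0 ?pw_ge0 // /F; case: ifP.
  have -> : \sum_M pm_weight R e M * F e M =
      \sum_M pm_weight R e M * ((graph_over c e \notin M) && (graph_over c' e \notin M))%:R.
    by apply: eq_bigr => M _; rewrite /F eE.
  exact: pm_weight_avoid2.
rewrite big_split /= prodr_const exprMn -exprM mul2n.
rewrite (_ : \prod_(e in _) _ = q^-1 ^+ #|edges_in (agreement c c')|) //.
rewrite -prodr_const big_mkcond [RHS]big_mkcond; apply: eq_bigr => e _.
by rewrite [e \in edges_in _]inE; case: (e \in edges G); case: (e \subset _).
Qed.

Lemma sum_agreement (x : R) c :
  \sum_(c' : {ffun G -> 'I_k}) x ^+ #|agreement c c'| = (k%:R - 1 + x) ^+ #|G|.
Proof.
transitivity (\prod_(v : G) \sum_(a : 'I_k) (if c v == a then x else 1)).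
  rewrite bigA_distr_bigA; apply: eq_bigr => c' _.
  rewrite -prodr_const big_mkcond; apply: eq_bigr => v _.
  by rewrite inE.
rewrite -prodr_const; apply: eq_bigr => v _.
rewrite (bigD1 (c v)) //= eqxx addrC; congr (_ + _).
rewrite (eq_bigr (fun=> 1)) => [|a /negbTE]; last by rewrite eq_sym => ->.
have := cardC1 (c v); rewrite card_ord sumr_const => ->.
by rewrite -subn1 natrB //; apply: leq_ltn_trans (ltn_ord (c v)).
Qed.

(** The excess of the second moment is the average of [q^-1 ^+ e(A)] over the
    agreement sets [A] of pairs of colourings. Under uniform colourings each
    vertex lies in [A] with probability [1 / k], independently, so a geometric
    weight [x ^+ #|A|] averages to [(1 + (x - 1) / k) ^+ #|G|]. *)
Lemma expect_colorable_ge (x y z : R) : (1 < k)%N ->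
  (forall A : {set G}, q^-1 ^+ #|edges_in A| <= x ^+ #|A| + z * y ^+ #|A|) ->
  2 - (1 + (k%:R - 1) ^- 3) ^+ #|edges G|
    * ((1 + (x - 1) / k%:R) ^+ #|G| + z * (1 + (y - 1) / k%:R) ^+ #|G|)
  <= esp (fun w => (colorable_on (edges G) w)%:R).
Proof.
move=> k1 dom; set m := #|edges G|; set d := 1 + _ ^- 3.
have k1R : (1 : R) < k%:R by rewrite ltr1n.
have k0R : (0 : R) < k%:R by apply: lt_trans k1R.
have q0 : (0 : R) < q by rewrite subr_gt0 invf_lt1.
have d0 : 0 <= d by rewrite addr_ge0 // invr_ge0 exprn_ge0 // subr_ge0 ltW.
pose X w : R := \sum_c (avoids (edges G) w c)%:R.
have EX : esp X = k%:R ^+ #|G| * q ^+ m.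
  rewrite /X expect_sum (eq_bigr (fun=> q ^+ m)) => [|c _]; last first.
    exact: expect_avoids.
  by rewrite sumr_const card_ffun card_ord -natrX mulr_natl.
have EX0 : 0 < esp X by rewrite EX mulr_gt0 ?exprn_gt0.
apply: le_trans (second_moment (B := colorable_on (edges G)) (f := X) pw_ge0 _ _).
- rewrite lerD2l lerN2 ler_pdivrMr ?exprn_gt0 //; apply: (@le_trans _ _
    (\sum_c \sum_c' q ^+ m.*2 * d ^+ m * (x ^+ #|agreement c c'| + z * y ^+ #|agreement c c'|))).
    have -> : esp (fun w => X w ^+ 2) = \sum_c \sum_c'
        esp (fun w => (avoids (edges G) w c)%:R * (avoids (edges G) w c')%:R).
      rewrite -[RHS](eq_bigr _ (fun c _ => expect_sum _ _ _)) -expect_sum.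
      by apply: eq_expect => w; rewrite expr2 /X big_distrlr.
    apply: ler_sum => c _; apply: ler_sum => c' _.
    apply: le_trans (expect_avoids2 _ _ k1) _; rewrite ler_wpM2l //.
    by rewrite mulr_ge0 ?exprn_ge0 // ltW.
  have avg (t : R) : 1 + (t - 1) / k%:R = (k%:R - 1 + t) / k%:R.
    by field; rewrite gt_eqF.
  under eq_bigr => c _ do
    rewrite -mulr_sumr big_split -mulr_sumr !sum_agreement /=.
  rewrite sumr_const card_ffun card_ord -[leLHS]mulr_natl natrX EX.
  rewrite !avg !expr_div_n -muln2 exprM le_eqVlt; apply/orP; left; apply/eqP.
  have : k%:R ^+ #|G| != 0 :> R by rewrite expf_neq0 // gt_eqF.
  set K := k%:R ^+ #|G|; set Q := q ^+ m; set D := d ^+ m.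
  set U := _ ^+ #|G|; set V := _ ^+ #|G|; move: K Q D U V => K Q D U V K0.
  by field.
- by rewrite gt_eqF.
- move=> w _; rewrite /colorable_on negb_exists => /forallP nav; rewrite /X big1 // => c _.
  by rewrite (negbTE (nav c)).
Qed.

End Moments.

Section Greedy.
Variables (R : realFieldType) (G : sgraph) (k d : nat).
Implicit Types (c : {ffun G -> 'I_k}) (S : {set G})
  (w : {ffun {set G} -> {set {set G * 'I_k}}}).

Local Notation esp := (expect (@pm_weight R G k)).
Local Notation q := (1 - k%:R^-1 : R).
Let pw_ge0 := @pm_weight_ge0 R G k.
Let pw_sum1 := @pm_weight_sum1 R G k.

Definition update c v a : {ffun G -> 'I_k} := [ffun u => if u == v then a else c u].

Definition star S v : {set {set G}} := [set e in edges_in S | v \in e].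

Lemma update_hit_inj c v e (M : {set {set G * 'I_k}}) a b :
  e \in edges G -> v \in e -> perfect_matching e M ->
  graph_over (update c v a) e \in M -> graph_over (update c v b) e \in M -> a = b.
Proof.
case/edgesP=> x [y [_ xy ->]]; rewrite !inE !graph_over2 => + pmM.
case/orP=> /eqP vE; rewrite !ffunE -vE !eqxx.
  rewrite eq_sym vE (negbTE xy); exact: pm_right_inj.
rewrite vE (negbTE xy); exact: pm_left_inj.
Qed.

(** Greedy colouring in a degenerate order. A colouring of [S :\ v] chosen as a
    function of the matchings inside [S :\ v] is independent of the matchings at
    [v], so it extends to [v] unless the at most [d] colours that these forbid
    form the whole list. *)
Lemma expect_greedy (S : {set G}) : (0 < k)%N ->
  (forall T : {set G}, T != set0 -> exists2 v, v \in T & (#|star T v| <= d)%N) ->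
  esp (fun w => (~~ colorable_on (edges_in S) w)%:R) <=
  #|S|%:R * (1 - q ^+ d) ^+ k.
Proof.
move=> k0 degen; have k0R : (0 : R) < k%:R by rewrite ltr0n.
have q0 : 0 <= q by rewrite subr_ge0 invf_le1 // ler1n.
have q1 : q <= 1 by rewrite lerBlDr lerDl invr_ge0 ler0n.
move cS: #|S| => n; elim: n S cS => [|n IH] S cS.
  rewrite mulr0n mul0r -[leRHS](expect_cst pw_sum1); apply: le_expect => // w _.
  rewrite (_ : colorable_on _ w) //; apply/existsP; exists [ffun=> Ordinal k0].
  apply/forall_inP => e; rewrite inE => /andP[/edgesP[u [v [_ _ ->]]]].
  by rewrite (cards0_eq cS) subset0 => /eqP/setP/(_ u); rewrite !inE eqxx.
have [v vS dv] : exists2 v, v \in S & (#|star S v| <= d)%N.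
  by apply: degen; rewrite -card_gt0 cS.
have cS' : #|S :\ v| = n by apply/eqP; rewrite -eqSS -cS (cardsD1 v S) vS.
set E' := edges_in (S :\ v); set N := star S v.
pose hit c (e : {set G}) (M : {set {set G * 'I_k}}) a := graph_over (update c v a) e \in M.
(* [first c] holds for exactly one [c] when [S :\ v] can be coloured: the
   colouring that the procedure has chosen before it reaches [v]. *)
pose first c w := [pick c' | avoids E' w c'] == Some c.
pose stuck c w := covered (hit c) N setT w.
have NE e : e \in N -> e \in edges G /\ v \in e.
  by rewrite !inE => /andP[/andP[-> _] ->].
apply: (@le_trans _ _ (esp (fun w => (~~ colorable_on E' w)%:R +
    \sum_c (first c w)%:R * (stuck c w)%:R))).
  apply: le_expect => // w _.
  have [chS|nchS] := boolP (colorable_on (edges_in S) w).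
    by rewrite addr_ge0 ?sumr_ge0 // => *; rewrite mulr_ge0.
  rewrite /colorable_on; case: (boolP [exists c, _]) => [exc|_]; last first.
    by rewrite lerDl sumr_ge0 // => *; rewrite mulr_ge0.
  case E: [pick c' | avoids E' w c'] => [c|]; last first.
    by case/existsP: exc => c; move: E; case: pickP => // ->.
  have /forall_inP avc : avoids E' w c by move: E; case: pickP => // c' av [<-].
  rewrite add0r (bigD1 c) //= /first E eqxx mul1r.
  suff -> : stuck c w by rewrite lerDl sumr_ge0 // => *; rewrite mulr_ge0.
  apply/forall_inP => a _; apply: contraR nchS.
  rewrite negb_exists_in => /forall_inP nhit; apply/existsP.
  exists (update c v a); apply/forall_inP => e eS.
  case: (boolP (v \in e)) => ve; first by apply: nhit; rewrite inE eS.
  rewrite (eq_graph_over (c' := c)) => [|u ue]; last first.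
    by rewrite ffunE; case: eqP => // uv; rewrite -uv ue in ve.
  apply: avc; move: eS; rewrite !inE => /andP[-> /subsetP eS] /=.
  apply/subsetP => u ue; rewrite !inE eS // andbT.
  by apply: contraNneq ve => <-.
rewrite expectD expect_sum -natr1 mulrDl mul1r lerD //; first exact: IH.
have stuckE c : esp (fun w => (stuck c w)%:R) <= (1 - q ^+ d) ^+ k.
  apply: le_trans (expect_covered pw_ge0 pw_sum1 _ _ setT k0) _.
  - move=> e M a b /NE[eE ve] /(pm_weight_neq0 eE) pmM.
    exact: update_hit_inj.
  - by move=> e a /NE[eE _]; apply: pm_weight_graph_over.
  rewrite cardsT card_ord lerXn2r ?nnegrE ?subr_ge0 ?exprn_ile1 //.
  by rewrite lerD2l lerN2 ler_wiXn2l.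
have indep c : esp (fun w => (first c w)%:R * (stuck c w)%:R) =
    esp (fun w => (first c w)%:R) * esp (fun w => (stuck c w)%:R).
  apply: (expect_indep pw_sum1 (A := E')) => w w' ww'.
    rewrite /first (eq_pick (_ : avoids E' w =1 avoids E' w')) // => c'.
    by apply: eq_forallb_in => e eE'; rewrite ww'.
  congr (nat_of_bool _)%:R; apply: eq_forallb_in => a _.
  apply: eq_existsb_in => e eN; rewrite /hit ww' // inE.
  have [_ ve] := NE e eN; rewrite inE negb_and; apply/orP; right.
  by apply/negP => /subsetP/(_ v ve); rewrite !inE eqxx.
under eq_bigr => c _ do rewrite indep.
apply: (@le_trans _ _ (\sum_c esp (fun w => (first c w)%:R) * (1 - q ^+ d) ^+ k)).
  by apply: ler_sum => c _; rewrite ler_wpM2l ?expect_ge0.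
rewrite -mulr_suml ler_piMl ?exprn_ge0 ?subr_ge0 ?exprn_ile1 //.
rewrite -expect_sum -[leRHS](expect_cst pw_sum1); apply: le_expect => // w _.
rewrite /first; case: [pick c' | _] => [c|]; last by rewrite big1.
rewrite (bigD1 c) //= eqxx big1 ?addr0 // => c' /negbTE cc'.
by rewrite (_ : _ == _ = false) //; apply/eqP => -[E]; rewrite E eqxx in cc'.
Qed.

End Greedy.

(** * Maximum density *)

Section Density.
Variables (R : realType) (G : sgraph).
Local Notation rho := (maxdensity R G).
Implicit Types S : {set G}.

Lemma card_edges_in_le S : #|edges_in S|%:R <= rho * #|S|%:R :> R.
Proof.
have [->|S0] := eqVneq S set0.
  rewrite cards0 mulr0 (_ : edges_in _ = set0) ?cards0 //.
  apply/setP => e; rewrite !in_set; apply/negP => /andP[/existsP[u /existsP[v]]].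
  by move=> /andP[_ /eqP->]; rewrite subset0 => /eqP/setP/(_ u); rewrite !inE eqxx.
have S0R : (0 : R) < #|S|%:R by rewrite ltr0n card_gt0.
rewrite -ler_pdivrMr //.
have subS : subgraph (S, edges_in S) && (S != set0).
  rewrite S0 andbT; apply/andP; split; first by apply/subsetP => e; rewrite inE => /andP[].
  by apply/forall_inP => e; rewrite inE => /andP[].
by rewrite /maxdensity; apply: (bigmax_sup (S, edges_in S)).
Qed.

Lemma maxdensity_attained : 0 < rho ->
  exists S (F : {set {set G}}),
    [/\ S != set0, F \subset edges_in S & #|F|%:R = rho * #|S|%:R :> R].
Proof.
move=> rho0.
have [T0 T0P] : exists T : {set G} * {set {set G}}, subgraph T && (T.1 != set0).
  apply/existsP; apply: contraTT rho0; rewrite negb_exists => /forallP no.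
  by rewrite /maxdensity big_pred0 ?ltxx // => T; apply: negbTE (no T).
have dge0 (T : {set G} * {set {set G}}) : (0 : R) <= density R T by rewrite divr_ge0.
have [[S F] SFP E] := @eq_bigmax _ _ _ 0 T0
  (fun T : {set G} * {set {set G}} => subgraph T && (T.1 != set0))
  (@density R G) T0P (fun T _ => dge0 T).
have /andP[/andP[/= FG /forall_inP FS] S0] :
  subgraph (S, F) && ((S, F).1 != set0) := SFP.
exists S, F; split=> //.
  by apply/subsetP => e eF; rewrite inE (subsetP FG) ?FS.
by rewrite /maxdensity E /density /= divfK // pnatr_eq0 cards_eq0.
Qed.

Lemma card_edges_in_sqr S : (#|edges_in S| <= #|S| * #|S|)%N.
Proof.
rewrite -cardsX; apply: leq_trans (leq_imset_card (fun p => [set p.1; p.2]) _).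
apply/subset_leq_card/subsetP => e; rewrite inE => /andP[/edgesP[u [v [_ _ ->]]] uvS].
apply/imsetP; exists (u, v) => //.
by rewrite inE !(subsetP uvS) // !inE eqxx ?orbT.
Qed.

Lemma maxdensity_le_card : rho <= #|G|%:R.
Proof.
have [|/maxdensity_attained[S [F [S0 FS FE]]]] := leP rho 0.
  by move/le_trans; apply.
have S0R : (0 : R) < #|S|%:R by rewrite ltr0n card_gt0.
rewrite -(ler_pM2r S0R) -FE -natrM ler_nat.
apply: leq_trans (subset_leq_card FS) (leq_trans (card_edges_in_sqr S) _).
by rewrite leq_mul2r max_card orbT.
Qed.

(** The degrees in the subgraph induced by [S] add up to twice its number of
    edges, so their average is at most [2 rho]. *)
Lemma exists_small_star S : S != set0 ->
  exists2 v, v \in S & #|star S v|%:R <= 2 * rho :> R.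
Proof.
move=> S0; apply/exists_inP; apply: contraT.
rewrite negb_exists_in => /forall_inP big.
have : \sum_(v in S) 2 * rho < \sum_(v in S) #|star S v|%:R.
  apply: ltr_sum => [|v vS]; last by rewrite ltNge big.
  by have /set0Pn[v vS] := S0; apply/hasP; exists v; rewrite ?mem_index_enum.
rewrite -natr_sum.
have -> : (\sum_(v in S) #|star S v| = 2 * #|edges_in S|)%N.
  transitivity (\sum_(e in edges_in S) \sum_(v in S) (v \in e))%N.
    rewrite exchange_big; apply: eq_bigr => v _; rewrite -card_sep_sum.
    by apply: eq_card.
  rewrite mulnC -sum_nat_const; apply: eq_bigr => e; rewrite inE.
  case/andP=> /edgesP[x [y [_ xy ->]]] xyS; rewrite -card_sep_sum.
  rewrite (_ : [set _ in _ | _] = [set x; y]) ?cards2 ?xy //.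
  by apply/setP => v; rewrite inE andb_idl // => /(subsetP xyS).
rewrite sumr_const -[X in X < _]mulr_natr natrM -mulrA ltr_pM2l // ltNge.
by rewrite card_edges_in_le.
Qed.

End Density.

(** * Explicit bounds on the colouring probability *)

Section ExplicitBounds.
Variables (R : realType) (G : sgraph) (k : nat).
Local Notation rho := (maxdensity R G).
Local Notation n := (#|G|%:R : R).
Local Notation kk := (k%:R - 1 : R).

Lemma colorable_probE : colorable_prob R G k =
  expect (@pm_weight R G k) (fun w => (colorable_on (edges G) w)%:R).
Proof.
rewrite /colorable_prob big_mkcond; apply: eq_bigr => w _.
rewrite weight_matching_choices; case: (boolP (w \in _)) => wm; last by rewrite mul0r.
by rewrite cover_colorableE //=; case: colorable_on; rewrite ?mulr1 ?mulr0.
Qed.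

Lemma colorable_prob_ge0 : 0 <= colorable_prob R G k.
Proof.
by rewrite colorable_probE expect_ge0 // => e M; apply: pm_weight_ge0.
Qed.

Lemma colorable_prob_le1 : colorable_prob R G k <= 1.
Proof.
rewrite colorable_probE -[leRHS](expect_cst (@pm_weight_sum1 R G k)).
apply: le_expect => [e M|w _]; first exact: pm_weight_ge0.
by case: colorable_on.
Qed.

Lemma exprn_le_expR (x y : R) m : 0 <= x -> x <= expR y -> x ^+ m <= expR (m%:R * y).
Proof. by move=> x0 xy; rewrite expRM_natl lerXn2r ?nnegrE ?expR_ge0. Qed.

Lemma inv_onem_inv_le_expR : (1 < k)%N -> (1 - k%:R^-1)^-1 <= expR kk^-1 :> R.
Proof.
move=> k1; have k1R : (1 : R) < k%:R by rewrite ltr1n.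
apply: le_trans (expR_ge1Dx _); rewrite le_eqVlt; apply/orP; left; apply/eqP.
by field; rewrite !gt_eqF ?subr_gt0 // (lt_trans _ k1R).
Qed.

(** First moment over the colourings of a densest subgraph: it has [s] vertices
    and [rho s] edges, so the expected number of its proper colourings is at
    most [expR (s * (ln k - rho / k))]. *)
Lemma colorable_prob_le_first_moment (eps : R) : 0 < eps -> 1 <= ln rho ->
  k%:R <= (1 - eps) * (rho / ln rho) ->
  colorable_prob R G k <= expR (- (eps * ln rho)).
Proof.
move=> eps0 ln1 kle.
have rho0 : 0 < rho by rewrite ltNge; apply/negP => /ln0 E; rewrite E ler10 in ln1.
have ln0 : 0 < ln rho by apply: lt_le_trans ln1.
have [S [F [S0 FS FE]]] := maxdensity_attained rho0.
have [k0|] := posnP k.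
  rewrite colorable_probE (@eq_expect _ _ _ _ _ (fun=> 0)); last first.
    move=> w; rewrite (_ : colorable_on _ w = false) //.
    apply: contraTF isT => /existsP[c _]; have /set0Pn[v _] := S0.
    by have := ltn_ord (c v); rewrite [X in (_ < X)%N]k0.
  by rewrite expect_cst ?expR_ge0 //; apply: pm_weight_sum1.
move=> k0; have k0R : (0 : R) < k%:R by rewrite ltr0n.
rewrite colorable_probE; apply: le_trans (expect_colorable_le R k0 FS) _.
have s1 : (1 : R) <= #|S|%:R by rewrite ler1n card_gt0.
have kln : k%:R * ln rho <= (1 - eps) * rho.
  by rewrite -ler_pdivlMr // -mulrA.
have ratio : (1 + eps) * ln rho <= rho / k%:R.
  rewrite ler_pdivlMr // -mulrA [ln _ * _]mulrC.
  apply: (@le_trans _ _ ((1 + eps) * ((1 - eps) * rho))).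
    by rewrite ler_wpM2l // addr_ge0 // ltW.
  have : 0 <= eps ^+ 2 * rho by rewrite mulr_ge0 ?sqr_ge0 // ltW.
  lra.
have lnk : ln k%:R <= ln rho.
  rewrite ler_ln ?posrE //; apply: (@le_trans _ _ (k%:R * ln rho)).
    by rewrite ler_peMr // ltW.
  apply: le_trans kln _; rewrite ler_piMl ?(ltW rho0) //; lra.
apply: (@le_trans _ _ (expR (#|S|%:R * ln k%:R) * expR (#|F|%:R * - k%:R^-1))).
  apply: ler_pM; rewrite ?exprn_ge0 // ?subr_ge0 ?invf_le1 ?ler1n //.
    by rewrite expRM_natl lnK ?posrE.
  by rewrite exprn_le_expR ?expR_ge1Dx // subr_ge0 invf_le1 // ler1n.
rewrite -expRD ler_expR FE.
have -> : #|S|%:R * ln k%:R + rho * #|S|%:R * - k%:R^-1 =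
    - (#|S|%:R * (rho / k%:R - ln k%:R)) by ring.
rewrite lerN2; apply: (@le_trans _ _ (rho / k%:R - ln k%:R)); first lra.
rewrite ler_peMl // subr_ge0; apply: le_trans lnk _; apply: le_trans ratio.
by rewrite ler_peMl ?(ltW ln0) //; lra.
Qed.

(** A union bound over the [n] vertices of the greedy procedure, with
    [q ^ -1 = 1 + 1 / (k - 1) <= expR (1 / (k - 1))]. *)
Lemma colorable_prob_ge_greedy : (1 < k)%N -> 0 <= rho ->
  1 - n * expR (- (k%:R * expR (- (2 * rho / kk)))) <= colorable_prob R G k.
Proof.
move=> k1 rho0; have k0 : (0 < k)%N by apply: ltnW.
have k1R : (1 : R) < k%:R by rewrite ltr1n.
have k0R : (0 : R) < k%:R by rewrite ltr0n.
have kk0 : 0 < kk by rewrite subr_gt0.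
have q0 : 0 < 1 - k%:R^-1 :> R by rewrite subr_gt0 invf_lt1.
pose d := Num.truncn (2 * rho).
have dle : d%:R <= 2 * rho by rewrite truncn_le mulr_ge0.
have degen (T : {set G}) : T != set0 -> exists2 v, v \in T & (#|star T v| <= d)%N.
  move=> /(exists_small_star R)[v vT le]; exists v => //.
  by rewrite truncn_ge_nat // mulr_ge0.
have := expect_greedy R [set: G] k0 degen; rewrite cardsT.
have -> : edges_in [set: G] = edges G.
  by apply/setP => e; rewrite [LHS]inE subsetT andbT.
have -> : expect (@pm_weight R G k) (fun w => (~~ colorable_on (edges G) w)%:R) =
    1 - colorable_prob R G k.
  apply/eqP; rewrite -subr_eq0 opprB addrA subr_eq0; apply/eqP.
  rewrite colorable_probE -expectD -[RHS](expect_cst (@pm_weight_sum1 R G k)).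
  by apply: eq_expect => w; case: colorable_on; rewrite /= ?addr0 ?add0r.
move=> H; rewrite lerBlDl -lerBlDr; apply: le_trans H _.
rewrite ler_wpM2l //; apply: (@le_trans _ _ (expR (k%:R * - (1 - k%:R^-1) ^+ d))).
  apply: exprn_le_expR (expR_ge1Dx _).
  by rewrite subr_ge0 exprn_ile1 ?(ltW q0) // lerBlDr lerDl invr_ge0 ler0n.
rewrite ler_expR mulrN lerN2 ler_wpM2l // expRN -[leRHS]invrK lef_pV2 ?posrE ?invr_gt0 ?exprn_gt0 ?expR_gt0 //.
rewrite -exprVn; apply: le_trans (exprn_le_expR _ _ (inv_onem_inv_le_expR k1)) _.
  by rewrite invr_ge0 ltW.
by rewrite ler_expR ler_wpM2r // invr_ge0 ltW.
Qed.

(** The agreement set [A] spans at most [a0 |A|] edges if [|A| <= a0], and at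
    most [rho |A|] edges always; the factor [expR (|A| - a0)], which is at least
    1 for the larger sets, makes their contribution summable. *)
Lemma colorable_prob_ge_second_moment (a0 : R) : (1 < k)%N -> 0 <= a0 -> 0 <= rho ->
  2 - expR (n * rho / kk ^+ 3) *
      (expR (n * (expR (a0 / kk) - 1) / k%:R) +
       expR (- a0) * expR (n * (expR 1 * expR (rho / kk)) / k%:R))
  <= colorable_prob R G k.
Proof.
move=> k1 a00 rho0; have k0 : (0 < k)%N by apply: ltnW.
have k1R : (1 : R) < k%:R by rewrite ltr1n.
have k0R : (0 : R) < k%:R by rewrite ltr0n.
have kk0 : 0 < kk by rewrite subr_gt0.
have q0 : 0 < 1 - k%:R^-1 :> R by rewrite subr_gt0 invf_lt1.
set x := expR (a0 / kk); set y := expR 1 * expR (rho / kk).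
have x1 : 1 <= x by rewrite -[leLHS]expR0 ler_expR divr_ge0 // ltW.
have y1 : 1 <= y by rewrite /y -expRD -[leLHS]expR0 ler_expR addr_ge0 // divr_ge0 // ltW.
have dom (A : {set G}) : (1 - k%:R^-1 : R)^-1 ^+ #|edges_in A| <=
    x ^+ #|A| + expR (- a0) * y ^+ #|A|.
  apply: le_trans (exprn_le_expR _ _ (inv_onem_inv_le_expR k1)) _.
    by rewrite invr_ge0 ltW.
  rewrite /x /y -expRD -!expRM_natl -expRD.
  have [Aa|aA] := leP #|A|%:R a0.
    rewrite -[leLHS]addr0 lerD ?expR_ge0 // ler_expR mulrA ler_wpM2r ?invr_ge0 ?(ltW kk0) //.
    apply: (@le_trans _ _ (#|A|%:R * #|A|%:R)); last by rewrite ler_wpM2l.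
    by rewrite -natrM ler_nat card_edges_in_sqr.
  rewrite -[leLHS]add0r lerD ?expR_ge0 // ler_expR.
  have : #|edges_in A|%:R * kk^-1 <= #|A|%:R * (rho / kk).
    rewrite mulrA ler_wpM2r ?invr_ge0 ?(ltW kk0) // mulrC.
    by rewrite mulrC [_ * rho]mulrC card_edges_in_le.
  by rewrite mulrDr mulr1; lra.
rewrite colorable_probE; apply: le_trans (expect_colorable_ge k1 dom).
rewrite lerD2l lerN2; apply: ler_pM.
- by rewrite exprn_ge0 // addr_ge0 // invr_ge0 exprn_ge0 // ltW.
- rewrite addr_ge0 ?mulr_ge0 ?expR_ge0 // exprn_ge0 // addr_ge0 // divr_ge0 //;
  by rewrite ?subr_ge0 // ltW.
- apply: le_trans (exprn_le_expR _ _ (expR_ge1Dx _)) _.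
    by rewrite addr_ge0 // invr_ge0 exprn_ge0 // ltW.
  rewrite ler_expR ler_wpM2r ?invr_ge0 ?exprn_ge0 ?(ltW kk0) //.
  rewrite mulrC (_ : edges G = edges_in [set: G]) -?cardsT ?card_edges_in_le //.
  by apply/setP => e; rewrite [RHS]inE subsetT andbT.
apply: lerD; last (rewrite ler_wpM2l ?expR_ge0 //).
  rewrite -mulrA; apply: exprn_le_expR (expR_ge1Dx _).
  by rewrite addr_ge0 // divr_ge0 ?subr_ge0 // ltW.
apply: le_trans (exprn_le_expR _ _ (expR_ge1Dx _)) _.
  by rewrite addr_ge0 // divr_ge0 ?subr_ge0 // ltW.
by rewrite ler_expR -mulrA ler_wpM2l // ler_wpM2r ?invr_ge0 ?(ltW k0R) // gerBl.
Qed.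

End ExplicitBounds.

Section Asymptotics.
Variables (R : realType) (G : sgraph) (k : nat).
Local Notation rho := (maxdensity R G).
Local Notation n := (#|G|%:R : R).
Local Notation r := (ln rho).
Local Notation L := (ln n).
Local Notation kk := (k%:R - 1 : R).

Lemma ln_neq0_gt0 (x : R) : ln x != 0 -> 0 < x.
Proof. by rewrite ltNge; apply: contraNN => /ln0 ->. Qed.

Lemma half_sqr_le_expR (x : R) : 0 <= x -> x ^+ 2 / 2 <= expR x.
Proof. by move=> /(expR_ge1Dxn 1); rewrite (_ : (2`!)%:R = 2 :> R) //; lra. Qed.

(** The greedy bound with [expR (- (2 rho / (k - 1))) >= rho ^ (- 1 / 2)]: the
    exponent is then at least [8 rho ^ (1 / 2) / ln rho >= rho ^ (1 / 4)], hence
    at least [(ln n) ^ 2 >= 2 ln n]. *)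
Lemma colorable_prob_ge_threshold : 1 <= r -> 2 <= L -> 8 * ln L <= r ->
  8 * (rho / r) <= k%:R -> 1 - expR (- L) <= colorable_prob R G k.
Proof.
move=> r1 L2 Lr kt.
have r0 : 0 < r by lra.
have rho0 : 0 < rho by apply: ln_neq0_gt0; rewrite gt_eqF.
have n0 : 0 < n by apply: ln_neq0_gt0; rewrite gt_eqF //; lra.
have t1 : 1 <= rho / r by rewrite ler_pdivlMr // mul1r ltW ?ln_sublinear.
have k8 : (8 : R) <= k%:R by lra.
have k1 : (1 < k)%N by rewrite -(ltr1n R); lra.
have kk0 : 0 < kk by lra.
have exponent : 2 * rho / kk <= r / 2.
  have H : 4 * (rho / r) <= kk by lra.
  rewrite ler_pdivrMr //; apply: (@le_trans _ _ (r / 2 * (4 * (rho / r)))).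
    by rewrite le_eqVlt; apply/orP; left; apply/eqP; field; rewrite gt_eqF.
  by rewrite ler_wpM2l //; lra.
have growth : 2 * L <= k%:R * expR (- (2 * rho / kk)).
  apply: (@le_trans _ _ (8 * (rho / r) * expR (- (r / 2)))); last first.
    by rewrite ler_pM // ?ler_expR ?lerN2 ?expR_ge0 //; lra.
  have LE : L <= expR (r / 8) by rewrite -[leLHS]lnK ?posrE ?ler_expR; lra.
  have L2E : L ^+ 2 <= expR (r / 4).
    have -> : r / 4 = 2%:R * (r / 8) by field.
    by rewrite expRM_natl lerXn2r ?nnegrE ?expR_ge0 //; lra.
  have E1 : r <= 8 * expR (r / 4) by have := expR_ge1Dx (r / 4); lra.
  apply: (@le_trans _ _ (expR (r / 4))); first by apply: le_trans L2E; nra.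
  have -> : 8 * (rho / r) * expR (- (r / 2)) = 8 * (rho * expR (- (r / 2))) / r.
    by ring.
  have -> : rho * expR (- (r / 2)) = expR (r / 4) * expR (r / 4).
    by rewrite -[X in X * _]lnK ?posrE // -!expRD; congr expR; field.
  by rewrite ler_pdivlMr // mulrCA ler_wpM2l ?expR_ge0.
apply: le_trans (colorable_prob_ge_greedy k1 (ltW rho0)).
rewrite lerD2l lerN2 -[X in X * _]lnK ?posrE // -expRD ler_expR; lra.
Qed.

(** With [b] defined by [1 - 3 b = 1 / (1 + eps / 2)] and the size threshold
    [a0 = #|G| ^ (1 - b)], each error term of the second-moment bound is at most
    a negative power of [#|G|], up to a constant factor. *)
Lemma colorable_prob_ge_sharp (eps b : R) : 0 < eps -> 1 - 3 * b = (1 + eps / 2)^-1 ->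
  1 <= r -> (1 - b / 8) * L <= r -> 4 / eps <= r -> 128 / b ^+ 2 <= L -> 2 / b <= L ->
  (1 + eps) * (rho / r) <= k%:R ->
  2 - expR (expR (- (b / 4 * L))) *
      (expR (expR 1 * expR (- (b / 4 * L))) + expR (- (4^-1 * L)))
  <= colorable_prob R G k.
Proof.
move=> eps0 bE r1 Lr r2 L1 L2 kt.
have r0 : 0 < r by lra.
have rho0 : 0 < rho by apply: ln_neq0_gt0; rewrite gt_eqF.
have i0 : 0 < (1 + eps / 2)^-1 by rewrite invr_gt0; lra.
have i1 : (1 + eps / 2)^-1 < 1 by rewrite invf_lt1; lra.
have b0 : 0 < b by lra.
have b3 : b < 3^-1 by lra.
have L0 : 0 < L by apply: lt_le_trans L2; rewrite divr_gt0.
have n0 : 0 < n by apply: ln_neq0_gt0; rewrite gt_eqF.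
have nE : n = expR L by rewrite lnK ?posrE.
have rhoE : rho = expR r by rewrite lnK ?posrE.
have rL : r <= L by rewrite ler_ln ?posrE // maxdensity_le_card.
have tr : r / 2 <= rho / r.
  rewrite ler_pdivlMr // [leRHS]rhoE; have := half_sqr_le_expR (ltW r0); lra.
have kkt : (1 + eps / 2) * (rho / r) <= kk.
  have : 1 <= eps / 2 * (rho / r).
    apply: (@le_trans _ _ (eps / 2 * (r / 2))); last by rewrite ler_wpM2l //; lra.
    by move: r2; rewrite ler_pdivrMr //; lra.
  lra.
have kkt1 : rho / r <= kk.
  by apply: le_trans kkt; rewrite ler_peMl ?divr_ge0 ?(ltW rho0) ?(ltW r0) //; lra.
have t0 : 0 < rho / r by rewrite divr_gt0.
have kk0 : 0 < kk by lra.
have k1 : (1 < k)%N by rewrite -(ltr1n R); lra.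
have k0R : (0 : R) < k%:R by lra.
have rexp : r <= expR (b / 8 * L).
  apply: le_trans rL _; apply: le_trans (half_sqr_le_expR _); last first.
    by rewrite mulr_ge0 //; lra.
  move: L1; rewrite ler_pdivrMr ?exprn_gt0 // => L1.
  have -> : (b / 8 * L) ^+ 2 / 2 = L * (L * b ^+ 2) / 128 by field.
  by rewrite ler_pdivlMr // ler_wpM2l // ltW.
have kklow : expR ((1 - b / 4) * L) <= kk.
  apply: le_trans kkt1; rewrite ler_pdivlMr // [leRHS]rhoE.
  apply: (@le_trans _ _ (expR ((1 - b / 4) * L) * expR (b / 8 * L))).
    by rewrite ler_wpM2l ?expR_ge0.
  by rewrite -expRD ler_expR; lra.
have dens : rho / kk <= (1 - 3 * b) * L.
  rewrite bE ler_pdivrMr //; apply: (@le_trans _ _ ((1 + eps / 2)^-1 * r * ((1 + eps / 2) * (rho / r)))).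
    rewrite le_eqVlt; apply/orP; left; apply/eqP; field.
    by rewrite !gt_eqF //; lra.
  apply: ler_pM => //.
  - by rewrite mulr_ge0 // ltW.
  - by rewrite mulr_ge0 ?(ltW t0) //; lra.
  - by rewrite ler_wpM2l // ltW.
have kkinv x : 0 <= x -> x / kk <= x * expR (- ((1 - b / 4) * L)).
  by move=> x0; rewrite ler_wpM2l // expRN lef_pV2 ?posrE ?expR_gt0.
have kinv x : 0 <= x -> x / k%:R <= x * expR (- ((1 - b / 4) * L)).
  move=> x0; apply: le_trans (kkinv _ x0); rewrite ler_wpM2l // lef_pV2 ?posrE //; lra.
set a0 := expR ((1 - b) * L); set delta := expR (- (b / 4 * L)).
have a00 : 0 <= a0 by apply: expR_ge0.
have term1 : n * rho / kk ^+ 3 <= delta.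
  apply: (@le_trans _ _ (n * n * expR (- ((1 - b / 4) * L)) ^+ 3)).
    rewrite -exprVn; apply: ler_pM; rewrite ?mulr_ge0 ?exprn_ge0 ?invr_ge0 ?(ltW rho0) ?(ltW kk0) //.
      by rewrite ler_wpM2l // maxdensity_le_card.
    rewrite lerXn2r ?nnegrE ?expR_ge0 ?invr_ge0 ?(ltW kk0) //.
    by have := kkinv 1 ler01; rewrite !mul1r.
  have -> : n * n = expR (L + L) by rewrite expRD -nE.
  rewrite -expRM_natl -expRD ler_expR.
  have : 3 * b * L <= L by rewrite ler_piMl //; lra.
  lra.
(* [term1], [term2] and [term3] bound the excess per edge, the contribution of
   the agreement sets of size at most [a0], and that of the larger ones. *)
have a0kk : a0 / kk <= expR (- (3 / 4 * b * L)).
  by apply: le_trans (kkinv _ a00) _; rewrite -expRD ler_expR; lra.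
have term2 : n * (expR (a0 / kk) - 1) / k%:R <= expR 1 * delta.
  have a0kk1 : a0 / kk <= 1.
    by apply: le_trans a0kk _; rewrite expR_le1 oppr_le0 !mulr_ge0 //; lra.
  have slope : expR (a0 / kk) - 1 <= expR 1 * (a0 / kk).
    have a0kk0 : 0 <= a0 / kk by rewrite divr_ge0 // ltW.
    have := expR_ge1Dx (- (a0 / kk)); rewrite expRN => H.
    have e0 := expR_gt0 (a0 / kk).
    have : (1 - a0 / kk) * expR (a0 / kk) <= 1.
      by rewrite -ler_pdivlMr // div1r.
    have : expR (a0 / kk) * (a0 / kk) <= expR 1 * (a0 / kk).
      by rewrite ler_wpM2r // ler_expR.
    lra.
  have slope0 : 0 <= expR (a0 / kk) - 1.
    by rewrite subr_ge0 -[leLHS]expR0 ler_expR divr_ge0 // ltW.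
  apply: le_trans (kinv _ _) _; first by rewrite mulr_ge0.
  apply: (@le_trans _ _ (n * (expR 1 * expR (- (3 / 4 * b * L)))
      * expR (- ((1 - b / 4) * L)))).
    rewrite ler_wpM2r ?expR_ge0 // ler_wpM2l // (le_trans slope) //.
    by rewrite ler_wpM2l ?expR_ge0.
  rewrite {1}nE -!expRD ler_expR.
  have : 0 <= b * L by rewrite mulr_ge0 // ltW.
  lra.
have term3 : expR (- a0) * expR (n * (expR 1 * expR (rho / kk)) / k%:R) <=
    expR (- (4^-1 * L)).
  have small : expR 1 * expR (- (b * L)) <= 2^-1.
    rewrite -expRD -[1 - _]opprK opprB expRN lef_pV2 ?posrE ?expR_gt0 //.
    apply: le_trans (expR_ge1Dx _).
    by move: L2; rewrite ler_pdivrMr //; lra.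
  have H : n * (expR 1 * expR (rho / kk)) / k%:R <= a0 / 2.
    apply: le_trans (kinv _ _) _; first by rewrite !mulr_ge0 ?expR_ge0.
    apply: (@le_trans _ _ (a0 * (expR 1 * expR (- (b * L))))); last first.
      by rewrite ler_wpM2l.
    rewrite {1}nE /a0 -!expRD ler_expR.
    have : 0 <= b * L by rewrite mulr_ge0 // ltW.
    lra.
  rewrite -expRD ler_expR; have := expR_ge1Dx ((1 - b) * L); rewrite -/a0.
  have : 3 * b * L <= L by rewrite ler_piMl //; lra.
  lra.
apply: le_trans (colorable_prob_ge_second_moment k1 a00 (ltW rho0)).
rewrite lerD2l lerN2; apply: ler_pM; rewrite ?addr_ge0 ?mulr_ge0 ?expR_ge0 //.
  by rewrite ler_expR.
by rewrite lerD // ler_expR.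
Qed.

End Asymptotics.

(** * Limits *)

From mathcomp Require Import all_classical all_reals all_analysis.

Import numFieldNormedType.Exports.

Local Open Scope classical_set_scope.
Local Open Scope ring_scope.

Lemma cvg_ln_pinfty (R : realType) (u : nat -> R) :
  u l @[l --> \oo] --> +oo -> ln (u l) @[l --> \oo] --> +oo.
Proof.
move=> /cvgryPge u_oo; apply/cvgryPge => A.
apply: filterS (u_oo (expR A)) => l ul.
by rewrite -ler_expR lnK // posrE (lt_le_trans (expR_gt0 A)).
Qed.

Lemma cvg_expRN_0 (R : realType) (c : R) (u : nat -> R) : 0 < c ->
  u l @[l --> \oo] --> +oo -> expR (- (c * u l)) @[l --> \oo] --> (0 : R).
Proof.
move=> c0 /cvgryPge u_oo.
have cu_oo : c * u l @[l --> \oo] --> +oo.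
  apply/cvgryPge => A; apply: filterS (u_oo (A / c)) => l.
  by rewrite ler_pdivrMr // mulrC.
exact: (cvg_comp _ _ cu_oo (@cvgr_expR R)).
Qed.

Section Limits.
Variables (R : realType) (G : nat -> sgraph).
Local Notation rho := (fun l => maxdensity R (G l)).
Local Notation r := (fun l => ln (maxdensity R (G l))).
Local Notation L := (fun l => ln (#|G l|%:R : R)).

Lemma non_DP_colorable_whp_of_le (eps : R) (kappa : nat -> nat) :
  rho l @[l --> \oo] --> +oo -> 0 < eps ->
  (\forall l \near \oo, (kappa l)%:R <= (1 - eps) * (rho l / r l)) ->
  non_DP_colorable_whp R G kappa.
Proof.
move=> rho_oo eps0 kle.
have r_oo := cvg_ln_pinfty rho_oo.
apply: (@squeeze_cvgr _ _ _ _ (fun=> 0) (fun l => expR (- (eps * r l)))).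
- near=> l; rewrite colorable_prob_ge0 /=; apply: colorable_prob_le_first_moment => //.
    by near: l; move/cvgryPge : r_oo; apply.
  by near: l.
- exact: cvg_cst.
- exact: cvg_expRN_0.
Unshelve. all: by end_near. Qed.

Lemma DP_colorable_whp_of_ge (lower : nat -> R) (kappa : nat -> nat) :
  (\forall l \near \oo, lower l <= colorable_prob R (G l) (kappa l)) ->
  lower l @[l --> \oo] --> (1 : R) -> DP_colorable_whp R G kappa.
Proof.
move=> lowerP lower1.
apply: (@squeeze_cvgr _ _ _ _ lower (fun=> 1)) => //; last exact: cvg_cst.
by apply: filterS lowerP => l ->; rewrite colorable_prob_le1.
Qed.

Lemma DP_colorable_whp_threshold (kappa : nat -> nat) :
  r l @[l --> \oo] --> +oo -> L l @[l --> \oo] --> +oo ->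
  r l / ln (L l) @[l --> \oo] --> +oo ->
  (\forall l \near \oo, 8 * (rho l / r l) <= (kappa l)%:R) ->
  DP_colorable_whp R G kappa.
Proof.
move=> r_oo L_oo /cvgryPge rL_oo kge; have lnL_oo := cvg_ln_pinfty L_oo.
move/cvgryPge in r_oo; move/cvgryPge in lnL_oo.
apply: (@DP_colorable_whp_of_ge (fun l => 1 - expR (- L l))).
  near=> l; apply: colorable_prob_ge_threshold.
  - by near: l; apply: r_oo.
  - by near: l; move/cvgryPge: L_oo; apply.
  - have lnL1 : 1 <= ln (L l) by near: l; apply: lnL_oo.
    rewrite -ler_pdivlMr; last by rewrite (lt_le_trans _ lnL1).
    by near: l; apply: rL_oo.
  - by near: l.
rewrite -[X in _ --> X]subr0; apply: cvgB; first exact: cvg_cst.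
under eq_fun do rewrite -[X in - X]mul1r.
exact: cvg_expRN_0.
Unshelve. all: by end_near. Qed.

Lemma DP_colorable_whp_sharp (eps : R) (kappa : nat -> nat) : 0 < eps ->
  r l @[l --> \oo] --> +oo -> L l @[l --> \oo] --> +oo ->
  r l / L l @[l --> \oo] --> (1 : R) ->
  (\forall l \near \oo, (1 + eps) * (rho l / r l) <= (kappa l)%:R) ->
  DP_colorable_whp R G kappa.
Proof.
move=> eps0 r_oo L_oo rL kge.
have i1 : (1 + eps / 2)^-1 < 1 by rewrite invf_lt1; lra.
pose b := (1 - (1 + eps / 2)^-1) / 3.
have bE : 1 - 3 * b = (1 + eps / 2)^-1 by rewrite /b [3 * _]mulrC divfK // opprB addrC subrK.
have b0 : 0 < b by rewrite /b; lra.
have delta0 : expR (- (b / 4 * L l)) @[l --> \oo] --> (0 : R).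
  by apply: cvg_expRN_0 => //; rewrite divr_gt0.
have tail0 : expR (- (4^-1 * L l)) @[l --> \oo] --> (0 : R) by apply: cvg_expRN_0.
move/cvgryPge in r_oo; move/cvgryPge in L_oo.
have rL_ge : \forall l \near \oo, (1 - b / 8) * L l <= r l.
  near=> l; have L1 : 1 <= L l by near: l; apply: L_oo.
  rewrite -ler_pdivlMr ?(lt_le_trans _ L1) //.
  near: l; apply: (cvgr_ge (1 : R)) rL _ _; lra.
apply: (@DP_colorable_whp_of_ge (fun l => 2 - expR (expR (- (b / 4 * L l))) *
    (expR (expR 1 * expR (- (b / 4 * L l))) + expR (- (4^-1 * L l))))).
  near=> l; apply: (colorable_prob_ge_sharp eps0 bE); near: l.
  - exact: r_oo.
  - exact: rL_ge.
  - exact: r_oo.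
  - exact: L_oo.
  - exact: L_oo.
  - exact: kge.
rewrite [X in _ --> X](_ : _ = 2 - expR 0 * (expR (expR 1 * 0) + 0)); last first.
  by rewrite mulr0 expR0; ring.
apply: cvgB; first exact: cvg_cst.
apply: cvgM; first exact: (cvg_comp _ _ delta0 (@continuous_expR R 0)).
apply: cvgD => //.
have edelta0 : expR 1 * expR (- (b / 4 * L l)) @[l --> \oo] --> expR 1 * 0.
  by apply: cvgM => //; exact: cvg_cst.
exact: (cvg_comp _ _ edelta0 (@continuous_expR R _)).
Unshelve. all: by end_near. Qed.

End Limits.

Theorem theorem5p1 (R : realType) (G : nat -> sgraph)
    (card_G : #|G l|%:R @[l --> \oo] --> (+oo : set_system R))
    (rho_G : maxdensity R (G l) @[l --> \oo] --> +oo) :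
  let rho := fun l => maxdensity R (G l) in
  let t := fun l => rho l / ln (rho l) in
  (ln (rho l) / ln (ln (#|G l|%:R)) @[l --> \oo] --> +oo ->
     DP_threshold G t)
  /\ (ln (rho l) / ln (#|G l|%:R) @[l --> \oo] --> (1 : R) ->
     sharp_DP_threshold G t).
Proof.
move=> rho t; have r_oo := cvg_ln_pinfty rho_G; have L_oo := cvg_ln_pinfty card_G.
have t_ge0 : \forall l \near \oo, 0 <= t l.
  near=> l; have r1 : 1 <= ln (rho l).
    by near: l; move/cvgryPge: r_oo; apply.
  have rho0 : 0 <= rho l by near: l; move/cvgryPge: rho_G; apply.
  by rewrite divr_ge0 // (le_trans ler01).
split=> ratio => [kappa|eps kappa eps0]; split.
- move=> /eqoP/(_ (1 / 2)) small; apply: (@non_DP_colorable_whp_of_le R G (1 / 2)) => //.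
  near=> l; have t0 : 0 <= t l by near: l.
  have : `|(kappa l)%:R| <= 1 / 2 * `|t l| by near: l; apply: small.
  rewrite ger0_norm // ger0_norm // => kt.
  by rewrite (_ : 1 - 1 / 2 = 1 / 2) //; lra.
- move=> /eqoP/(_ 8^-1) small; apply: DP_colorable_whp_threshold => //.
  near=> l; have t0 : 0 <= t l by near: l.
  have : `|t l| <= 8^-1 * `|(kappa l)%:R| by near: l; apply: small.
  by rewrite ger0_norm // ger0_norm // ler_pdivlMl.
- exact: non_DP_colorable_whp_of_le.
- exact: DP_colorable_whp_sharp.
Unshelve. all: by end_near. Qed.
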